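(* Let $W_1,W_2$ be Coxeter groups with simple reflections $S_1,S_2$, and let $J$ be a set with inclusions $i_k:J\to S_k$ ($k=1,2$) such that $(W_1)_{i_1(J)}\cong (W_2)_{i_2(J)}$ as Coxeter groups (compatibly with $i_1,i_2$). Let $\mathscr H_1,\mathscr H_2$ be the Hecke algebras of $W_1,W_2$, let $\mathscr H_J$ be the Hecke algebra of the common parabolic subgroup $W_J$, and let $\tilde E=\mathscr H_1\otimes_{\mathscr H_J}\mathscr H_2$ with the $W_1$-graph structure $\Lambda$ obtained by inducing the $W_J$-graph $\mathrm{Res}_J\Gamma_{W_2}$. Then $\tilde E$ has a filtration with cellular subquotients that are isomorphic as $W_1$-graphs to $\Gamma_{W_1}$. In particular, the left cells of $\Lambda$ are isomorphic (as $W_1$-graphs) to those occurring in $\Gamma_{W_1}$.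
   Context: For a Coxeter group $(W,S)$ and $J\subseteq S$, $W_J$ is the parabolic subgroup generated by $J$ and $W^J$ is the set of minimal length representatives of the left cosets $wW_J$. Let $A=\mathbb Z[u,u^{-1}]$, $A^-=\mathbb Z[u^{-1}]$, with ring involution $\bar{\cdot}$ of $A$ given by $\bar u=u^{-1}$. The Hecke algebra $\mathscr H$ of $W$ is the free $A$-module with basis $\{T_w:w\in W\}$ and relations $T_vT_w=T_{vw}$ if $\ell(vw)=\ell(v)+\ell(w)$ and $(T_s-u)(T_s+u^{-1})=0$ for $s\in S$; $\mathscr H_J\subseteq\mathscr H$ is the span of $\{T_w:w\in W_J\}$. The involution $\bar{\cdot}$ of $\mathscr H$ is semilinear with $\overline{T_w}=T_{w^{-1}}^{-1}$. Put $C'_s=T_s+u^{-1}$ and $[2]=u+u^{-1}$. The Kazhdan-Lusztig basis $\Gamma_W=\{C'_w:w\in W\}$ is the unique $\bar{\cdot}$-invariant basis with $C'_w\equiv T_w \bmod u^{-1}A^-\{T_x:x\in W\}$. A $W$-graph is a vertex set $\Gamma$ with weights $\mu(\delta,\gamma)\in\mathbb Z$ and descent sets $L(\gamma)\subseteq S$ such that $A\Gamma$ is a left $\mathscr H$-module via $C'_s\gamma=[2]\gamma$ if $s\in L(\gamma)$ and $C'_s\gamma=\sum_{\delta:\,s\in L(\delta)}\mu(\delta,\gamma)\delta$ if $s\notin L(\gamma)$. Then $A\Gamma$ has a semilinear involution $\bar{\cdot}$ fixing each $\gamma\in\Gamma$. Two $W$-graphs are isomorphic if there is a bijection $\alpha$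 of vertex sets with $L(\alpha(\gamma))=L(\gamma)$ and $\mu(\alpha(\delta),\alpha(\gamma))=\mu(\delta,\gamma)$ whenever $L(\delta)\not\subseteq L(\gamma)$. $\Gamma_W$ is a $W$-graph on the left regular representation. $\mathrm{Res}_J$ of a $W$-graph is the $W_J$-graph obtained by intersecting descent sets with $J$. Induction (Howlett-Yin): for a $W_J$-graph $\Gamma$ with $E=A\Gamma$, the module $\mathscr H\otimes_{\mathscr H_J}E$ has involution $\overline{h\otimes e}=\bar h\otimes\bar e$ and a unique $\bar{\cdot}$-invariant basis $\{\tilde C'_{w,\gamma}:w\in W^J,\gamma\in\Gamma\}$ with $\tilde C'_{w,\gamma}\equiv T_w\otimes\gamma \bmod u^{-1}A^-\{T_x\otimes\delta:x\in W^J,\delta\in\Gamma\}$; this basis gives $\mathscr H\otimes_{\mathscr H_J}E$ a $W$-graph structure. For a $W$-graph $\Gamma$, the preorder $\leq_\Gamma$ is generated by $\delta\le_\Gamma\gamma$ if $\delta$ appears with nonzero coefficient in $h\gamma$ for some $h\in\mathscr H$. Its equivalence classes are the (left) cells. A cellular submodule, quotient or subquotient of $A\Gamma$ is one spanned by (the image of) a subset of $\Gamma$; it inherits a $W$-graph structure. *)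

(* Defs.v *)
From HB Require Import structures.
From mathcomp Require Import all_boot all_order all_algebra.
From mathcomp Require Import fraction finmap.
From mathcomp Require Import boolp classical_sets functions cardinality fsbigop.
From mathcomp Require Import wochoice ring.
From Stdlib Require Import Relations.

Set Implicit Arguments.
Unset Strict Implicit.
Unset Printing Implicit Defensive.

Import GRing.Theory.
Local Open Scope classical_set_scope.
Local Open Scope ring_scope.

(** * The ring A = Z[u, u^-1] and its involution *)

(* A is realised as the subring of Q(u) of all p / u^n with p in Z[u]. *)
Section LaurentSubring.

Local Notation K := {fraction {poly int}}.
Local Notation X := (tofrac 'X : K).

Definition laurent_pred : {pred K} :=
  fun x => `[< exists (p : {poly int}) (n : nat), x = tofrac p / X ^+ n >].

Lemma fracX_neq0 : X != 0.
Proof. by rewrite tofrac_eq0 polyX_eq0. Qed.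

Lemma fracXn_neq0 n : X ^+ n != 0.
Proof. by rewrite expf_neq0 // fracX_neq0. Qed.

Fact laurent_subring_closed : subring_closed laurent_pred.
Proof.
split.
- by apply/asboolP; exists 1, 0%N; rewrite expr0 divr1 rmorph1.
- move=> x y /asboolP[p [n ->]] /asboolP[q [m ->]]; apply/asboolP.
  exists (p * 'X ^+ m - q * 'X ^+ n), (n + m)%N.
  rewrite rmorphB !rmorphM !rmorphXn /= exprD mulrBl; congr (_ - _).
    by rewrite -mulf_div divff ?fracXn_neq0 // mulr1.
  by rewrite [X ^+ n * _]mulrC -mulf_div divff ?fracXn_neq0 // mulr1.
- move=> x y /asboolP[p [n ->]] /asboolP[q [m ->]]; apply/asboolP.
  by exists (p * q), (n + m)%N; rewrite rmorphM /= exprD mulf_div.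
Qed.

HB.instance Definition _ :=
  GRing.isSubringClosed.Build K laurent_pred laurent_subring_closed.

Record laurent := Laurent { laurent_val :> K; _ : laurent_val \in laurent_pred }.

HB.instance Definition _ := [isSub for laurent_val].
HB.instance Definition _ := [Choice of laurent by <:].
HB.instance Definition _ := [SubChoice_isSubComNzRing of laurent by <:].

Fact u_subproof : X \in laurent_pred.
Proof. by apply/asboolP; exists 'X, 0%N; rewrite expr0 divr1. Qed.

Fact uinv_subproof : X^-1 \in laurent_pred.
Proof. by apply/asboolP; exists 1, 1%N; rewrite rmorph1 expr1 div1r. Qed.

Definition u : laurent := Laurent u_subproof.
Definition uinv : laurent := Laurent uinv_subproof.

Lemma u_uinv : u * uinv = 1.
Proof. by apply: val_inj => /=; rewrite mulfV ?fracX_neq0. Qed.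

Lemma un_uinvn n : u ^+ n * uinv ^+ n = 1.
Proof. by rewrite -exprMn u_uinv expr1n. Qed.

Definition evalA (a : laurent) (p : {poly int}) : laurent :=
  (map_poly (intmul 1) p).[a].

Lemma evalA_zmod a : zmod_morphism (evalA a).
Proof. by move=> p q; rewrite /evalA rmorphB hornerD hornerN. Qed.

Lemma evalA_monoid a : monoid_morphism (evalA a).
Proof.
split=> [|p q]; first by rewrite /evalA rmorph1 hornerC.
by rewrite /evalA rmorphM hornerM.
Qed.

HB.instance Definition _ a :=
  GRing.isZmodMorphism.Build {poly int} laurent (evalA a) (evalA_zmod a).
HB.instance Definition _ a :=
  GRing.isMonoidMorphism.Build {poly int} laurent (evalA a) (evalA_monoid a).

Lemma evalAX a : evalA a 'X = a.
Proof. by rewrite /evalA map_polyX hornerX. Qed.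

Lemma evalAu p : val (evalA u p) = tofrac p.
Proof.
elim/poly_ind: p => [|p c IH]; first by rewrite !rmorph0.
have -> : c%:P = c%:~R :> {poly int} by rewrite -{1}[c]intz rmorph_int.
by rewrite !rmorphD !rmorphM !rmorph_int /= evalAX -IH.
Qed.

Lemma evalAu_inj : injective (evalA u).
Proof. by move=> p q E; apply/eqP; rewrite -tofrac_eq -!evalAu E. Qed.

Lemma evalAMXn a p n : evalA a (p * 'X ^+ n) = evalA a p * a ^+ n.
Proof. by rewrite rmorphM rmorphXn /= evalAX. Qed.

Lemma laurentP (x : laurent) :
  exists pn : {poly int} * nat, x = evalA u pn.1 * uinv ^+ pn.2.
Proof.
have /asboolP[p [n xE]] := valP x; exists (p, n).
by apply: val_inj; rewrite rmorphM rmorphXn /= -[laurent_val _]/(val _) evalAu exprVn -xE.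
Qed.

Definition bar (x : laurent) : laurent :=
  let pn := sval (cid (laurentP x)) in evalA uinv pn.1 * u ^+ pn.2.

Lemma bar_eval p n : bar (evalA u p * uinv ^+ n) = evalA uinv p * u ^+ n.
Proof.
rewrite /bar; case: cid => -[q m] /= E.
have {E} E : p * 'X ^+ m = q * 'X ^+ n.
  apply: evalAu_inj; rewrite !evalAMXn.
  rewrite -[LHS]mulr1 -(un_uinvn n) -[RHS]mulr1 -(un_uinvn m).
  have -> : evalA u p * u ^+ m * (u ^+ n * uinv ^+ n)
          = (evalA u p * uinv ^+ n) * (u ^+ m * u ^+ n) by ring.
  by rewrite E; ring.
have {}E : evalA uinv p * uinv ^+ m = evalA uinv q * uinv ^+ n.
  by rewrite -!evalAMXn E.
rewrite -[LHS]mulr1 -(un_uinvn n) -[RHS]mulr1 -(un_uinvn m).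
have -> : evalA uinv q * u ^+ m * (u ^+ n * uinv ^+ n)
        = (evalA uinv q * uinv ^+ n) * (u ^+ m * u ^+ n) by ring.
by rewrite -E; ring.
Qed.

Fact bar_zmod : zmod_morphism bar.
Proof.
move=> x y; have [[p n] /= ->] := laurentP x; have [[q m] /= ->] := laurentP y.
have H (a b v w : laurent) : v * w = 1 ->
    a * w ^+ n - b * w ^+ m = (a * v ^+ m - b * v ^+ n) * w ^+ (n + m).
  move=> vw; have vwk k : v ^+ k * w ^+ k = 1 by rewrite -exprMn vw expr1n.
  rewrite exprD mulrBl; congr (_ - _).
    by rewrite -[LHS]mulr1 -(vwk m); ring.
  by rewrite -[LHS]mulr1 -(vwk n); ring.
have -> : evalA u p * uinv ^+ n - evalA u q * uinv ^+ m =
    evalA u (p * 'X ^+ m - q * 'X ^+ n) * uinv ^+ (n + m).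
  by rewrite rmorphB /= !evalAMXn; apply: H; exact: u_uinv.
rewrite !bar_eval rmorphB /= !evalAMXn; apply/esym/H.
by rewrite mulrC u_uinv.
Qed.

Fact bar_monoid : monoid_morphism bar.
Proof.
split.
  have {1}-> : 1 = evalA u 1 * uinv ^+ 0 by rewrite rmorph1 mulr1.
  by rewrite bar_eval rmorph1 mulr1.
move=> x y; have [[p n] /= ->] := laurentP x; have [[q m] /= ->] := laurentP y.
have -> : evalA u p * uinv ^+ n * (evalA u q * uinv ^+ m) =
    evalA u (p * q) * uinv ^+ (n + m) by rewrite rmorphM exprD; ring.
by rewrite !bar_eval rmorphM exprD; ring.
Qed.

HB.instance Definition _ := GRing.isZmodMorphism.Build laurent laurent bar bar_zmod.
HB.instance Definition _ :=
  GRing.isMonoidMorphism.Build laurent laurent bar bar_monoid.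

Lemma bar_u : bar u = uinv.
Proof.
have {1}-> : u = evalA u 'X * uinv ^+ 0 by rewrite evalAX mulr1.
by rewrite bar_eval evalAX mulr1.
Qed.

End LaurentSubring.

(** * Linear algebra over a fixed basis *)

Section Bases.
Variables (V : choiceType) (M : lmodType laurent) (b : V -> M).

Definition lincomb (a : {fsfun V -> laurent with 0}) : M :=
  \sum_(x <- finsupp a) a x *: b x.

Definition is_basis : Prop :=
  forall m : M, exists! a : {fsfun V -> laurent with 0}, m = lincomb a.

Definition span_of (X : set V) : set M :=
  [set m | exists2 a : {fsfun V -> laurent with 0},
     (forall x, a x != 0 -> X x) & m = lincomb a].

Definition occurs (x : V) (m : M) : Prop :=
  exists2 a : {fsfun V -> laurent with 0}, m = lincomb a & a x != 0.

(* The ideal u^-1 Z[u^-1] of Z[u^-1]. *)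
Definition uAminus : set laurent :=
  [set a | exists p : {poly int}, a = uinv * evalA uinv p].

(* u^-1 A^- { b x : x }, the A^- -span taken inside [M]. *)
Definition uAminus_span : set M :=
  [set m | exists2 a : {fsfun V -> laurent with 0},
     (forall x, uAminus (a x)) & m = lincomb a].

End Bases.

Definition restrict_scalars (B R : nzRingType) (f : {rmorphism B -> R})
  (M : lmodType R) : Type := M.

Section RestrictScalars.
Variables (B R : nzRingType) (f : {rmorphism B -> R}) (M : lmodType R).
Local Notation restrict_scalars := (restrict_scalars f M).

HB.instance Definition _ := GRing.Zmodule.copy restrict_scalars M.

Definition restrict_scale (a : B) (m : restrict_scalars) : restrict_scalars :=
  f a *: (m : M).

Fact restrict_scaleA a b v :
  restrict_scale a (restrict_scale b v) = restrict_scale (a * b) v.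
Proof. by rewrite /restrict_scale scalerA rmorphM. Qed.

Fact restrict_scale1 : left_id 1 restrict_scale.
Proof. by move=> v; rewrite /restrict_scale rmorph1 scale1r. Qed.

Fact restrict_scaleDr : right_distributive restrict_scale +%R.
Proof. by move=> a v w; rewrite /restrict_scale scalerDr. Qed.

Fact restrict_scaleDl v : {morph restrict_scale^~ v : a b / a + b}.
Proof. by move=> a b; rewrite /restrict_scale rmorphD scalerDl. Qed.

HB.instance Definition _ := GRing.Zmodule_isLmodule.Build B restrict_scalars
  restrict_scaleA restrict_scale1 restrict_scaleDr restrict_scaleDl.

End RestrictScalars.

(* A module over an A-algebra, viewed as an A-module. *)
Notation amod H M := (restrict_scalars (GRing.in_alg H) M).

(** * Coxeter groups *)

(* Congruence on words generated by the Coxeter relations (s t)^m(s,t) = 1;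
   m(s,t) = 0 stands for infinity and imposes no relation.  Since m(s,s) = 1
   gives s^2 = 1, the monoid presented here is the Coxeter group itself. *)
Inductive cox_equiv (S : Type) (m : S -> S -> nat) : seq S -> seq S -> Prop :=
| cox_equiv_rel s t : cox_equiv m (flatten (nseq (m s t) [:: s; t])) [::]
| cox_equiv_refl l : cox_equiv m l l
| cox_equiv_sym l l' : cox_equiv m l l' -> cox_equiv m l' l
| cox_equiv_trans l l' l'' :
    cox_equiv m l l' -> cox_equiv m l' l'' -> cox_equiv m l l''
| cox_equiv_cat k k' l l' :
    cox_equiv m k k' -> cox_equiv m l l' -> cox_equiv m (k ++ l) (k' ++ l').

Record coxeterSystem := CoxeterSystem {
  cox_group :> groupType;
  cox_gen : choiceType;
  refl : cox_gen -> cox_group;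
  cox_mx : cox_gen -> cox_gen -> nat;
  cox_mx_eq1 : forall s t, (cox_mx s t == 1%N) = (s == t);
  cox_mx_sym : forall s t, cox_mx s t = cox_mx t s;
  cox_generated : forall w : cox_group,
    exists l : seq cox_gen, w = (\prod_(s <- l) refl s)%g;
  cox_presented : forall l l' : seq cox_gen,
    (\prod_(s <- l) refl s)%g = (\prod_(s <- l') refl s)%g <->
    cox_equiv cox_mx l l'
}.

Section Coxeter.
Variable C : coxeterSystem.

Definition expressible (w : C) (n : nat) : bool :=
  `[< exists2 l : seq (cox_gen C), size l = n & w = (\prod_(s <- l) refl s)%g >].

Fact expressible_ex w : exists n, expressible w n.
Proof.
by have [l ->] := cox_generated w; exists (size l); apply/asboolP; exists l.
Qed.

Definition cox_length (w : C) : nat := ex_minn (expressible_ex w).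

Definition parabolic (K : set (cox_gen C)) : set C :=
  smallest [set P : set C | P 1%g /\ forall x y, P x -> P y -> P (x * y^-1)%g]
    (@refl C @` K).

(* W^K: minimal length representatives of the left cosets w W_K. *)
Definition min_reps (K : set (cox_gen C)) : set C :=
  [set w | forall v, parabolic K v -> (cox_length w <= cox_length (w * v)%g)%N].

End Coxeter.

(* [f] is an isomorphism of [CJ] onto the parabolic subgroup generated by
   [i J], matching the simple reflections along [i]. *)
Definition parabolic_iso (CJ C : coxeterSystem)
    (i : cox_gen CJ -> cox_gen C) (f : CJ -> C) : Prop :=
  [/\ injective i,
      {morph f : x y / (x * y)%g},
      injective f,
      range f = parabolic (range i) &
      forall s, f (refl s) = refl (i s)].

(** * Hecke algebras and Kazhdan-Lusztig bases *)

Record heckeAlgebra (C : coxeterSystem) := HeckeAlgebra {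
  hecke_alg :> algType laurent;
  hecke_T : C -> hecke_alg;
  hecke_T_basis : is_basis hecke_T;
  hecke_T_mul : forall v w : C, cox_length (v * w)%g = (cox_length v + cox_length w)%N ->
    hecke_T v * hecke_T w = hecke_T (v * w)%g;
  hecke_T_quad : forall s : cox_gen C,
    (hecke_T (refl s) - u%:A) * (hecke_T (refl s) + uinv%:A) = 0
}.

Definition C's (C : coxeterSystem) (H : heckeAlgebra C) (s : cox_gen C) : H :=
  hecke_T H (refl s) + uinv%:A.

Definition quantum2 : laurent := u + uinv.

Definition is_hecke_bar (C : coxeterSystem) (H : heckeAlgebra C)
    (barH : H -> H) : Prop :=
  [/\ {morph barH : x y / x + y},
      forall (a : laurent) (x : H), barH (a *: x) = bar a *: barH x &
      forall w : C, barH (hecke_T H w) * hecke_T H (w^-1)%g = 1 /\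
                    hecke_T H (w^-1)%g * barH (hecke_T H w) = 1].

Definition is_KL_basis (C : coxeterSystem) (H : heckeAlgebra C)
    (C' : C -> H) : Prop :=
  is_basis C' /\
  exists2 barH, is_hecke_bar barH &
    forall w, barH (C' w) = C' w /\ uAminus_span (hecke_T H) (C' w - hecke_T H w).

(** * W-graphs *)

Record wgraph (S : Type) (V : choiceType) := WGraph {
  wg_mu : V -> V -> int;
  wg_desc : V -> set S
}.

(* [G] is a W-graph with A[G] realised as the [H]-module [M], the vertex [x]
   being the basis vector [b x].  The finiteness condition makes the sum
   defining the action of C'_s meaningful. *)
Definition wgraph_on (C : coxeterSystem) (H : heckeAlgebra C) (V : choiceType)
    (M : lmodType H) (b : V -> M) (G : wgraph (cox_gen C) V) : Prop :=
  is_basis (b : V -> amod H M) /\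
  forall (s : cox_gen C) (x : V),
    (wg_desc G x s -> C's H s *: b x = quantum2%:A *: b x) /\
    (~ wg_desc G x s ->
       finite_set [set y | wg_desc G y s /\ wg_mu G y x != 0] /\
       C's H s *: b x = \sum_(y \in [set y | wg_desc G y s]) b y *~ wg_mu G y x).

Definition wgraph_isomorphic (S : Type) (V V' : choiceType)
    (G : wgraph S V) (G' : wgraph S V') : Prop :=
  exists alpha : V -> V',
    [/\ bijective alpha,
        forall x, wg_desc G' (alpha x) = wg_desc G x &
        forall y x, ~ (wg_desc G y `<=` wg_desc G x) ->
          wg_mu G' (alpha y) (alpha x) = wg_mu G y x].

Definition res_wgraph (J S : Type) (i : J -> S) (V : choiceType)
    (G : wgraph S V) : wgraph J V :=
  WGraph (wg_mu G) (fun x => i @^-1` wg_desc G x).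

Definition sub_wgraph (S : Type) (V : choiceType) (G : wgraph S V)
    (X : set V) : wgraph S X :=
  WGraph (fun y x : X => wg_mu G (val y) (val x)) (fun x : X => wg_desc G (val x)).

Section Restriction.
Variables (CJ C : coxeterSystem) (HJ : heckeAlgebra CJ) (H : heckeAlgebra C).
Variables (i : cox_gen CJ -> cox_gen C) (iota : {lrmorphism HJ -> H}).
Variables (V : choiceType) (M : lmodType H) (b : V -> M).

Lemma res_wgraph_on (G : wgraph (cox_gen C) V) :
  (forall s, iota (hecke_T HJ (refl s)) = hecke_T H (refl (i s))) ->
  wgraph_on b G ->
  wgraph_on (b : V -> restrict_scalars iota M) (res_wgraph i G).
Proof.
move=> iotaT; have iotaA (a : laurent) : iota a%:A = a%:A by rewrite linearZ /= rmorph1.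
case=> bB bG; split.
  have lE (a : {fsfun V -> laurent with 0}) :
      lincomb (b : V -> amod HJ (restrict_scalars iota M)) a =
      lincomb (b : V -> amod H M) a.
    by apply: eq_bigr => x _; rewrite -[LHS]/(iota (a x)%:A *: b x) iotaA.
  move=> m; have [a [mE aU]] := bB m; exists a; split=> [|a' m'E].
    by rewrite lE.
  by apply: aU; rewrite -lE.
move=> s x; have [bG1 bG2] := bG (i s) x.
have C'sE : iota (C's HJ s) = C's H (i s) by rewrite rmorphD /= iotaT iotaA.
split=> [sx|nsx].
  by rewrite -[LHS]/(iota (C's HJ s) *: b x) C'sE bG1 // -iotaA.
have [fin sE] := bG2 nsx; split=> //.
by rewrite -[LHS]/(iota (C's HJ s) *: b x) C'sE sE.
Qed.

End Restriction.

Section Cells.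
Variables (C : coxeterSystem) (H : heckeAlgebra C) (V : choiceType).
Variables (M : lmodType H) (b : V -> M).

Local Notation bA := (b : V -> amod H M).

Definition wg_le : V -> V -> Prop :=
  clos_refl_trans V (fun y x => exists h : H, occurs bA y (h *: b x)).

Definition is_cell (X : set V) : Prop :=
  exists x, X = [set y | wg_le y x /\ wg_le x y].

Definition cellular_submodule (X : set V) : Prop :=
  forall (h : H) (m : M), span_of bA X m -> span_of bA X (h *: m).

(* An exhaustive filtration of [M] by cellular submodules, indexed by a
   well-ordered set (which has to be finite if [V] is). *)
Definition cellular_filtration (I : choiceType) (R : rel I)
    (F : I -> set V) : Prop :=
  [/\ well_order R,
      forall i, cellular_submodule (F i),
      forall i j, R i j -> F i `<=` F j &
      \bigcup_i F i = setT].

End Cells.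

(* Vertices spanning the subquotient of [F i] by the sum of the earlier steps. *)
Definition layer (V I : choiceType) (R : rel I) (F : I -> set V) (i : I) : set V :=
  F i `\` \bigcup_(j in [set j | R j i && (j != i)]) F j.

(** * Induction *)

Section Tensor.
Variables (B R : nzRingType) (iota : {rmorphism B -> R}) (E : lmodType B).

Definition balanced (N : zmodType) (beta : R -> E -> N) : Prop :=
  [/\ forall h h' e, beta (h + h') e = beta h e + beta h' e,
      forall h e e', beta h (e + e') = beta h e + beta h e' &
      forall h x e, beta (h * iota x) e = beta h (x *: e)].

(* [M], with h (x) e := [tau h e], is the left R-module R (x)_B E. *)
Definition is_tensor (M : lmodType R) (tau : R -> E -> M) : Prop :=
  [/\ balanced tau,
      forall h h' e, tau (h * h') e = h *: tau h' e &
      forall (N : zmodType) (beta : R -> E -> N), balanced beta ->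
        exists! g : M -> N, zmod_morphism g /\ forall h e, g (tau h e) = beta h e].

End Tensor.

Section Induction.
Variables (CJ C : coxeterSystem) (HJ : heckeAlgebra CJ) (H : heckeAlgebra C).
Variables (i : cox_gen CJ -> cox_gen C) (iota : {lrmorphism HJ -> H}).
Variables (V : choiceType) (E : lmodType HJ) (e : V -> E).
Variables (M : lmodType H) (tau : H -> E -> M).

(* The semilinear involution of E = A[G] fixing every vertex. *)
Definition is_wgraph_bar (barE : E -> E) : Prop :=
  [/\ {morph barE : x y / x + y},
      forall (a : laurent) (x : E), barE (a%:A *: x) = (bar a)%:A *: barE x &
      forall x, barE (e x) = e x].

Definition induced_vertex : choiceType :=
  (min_reps (range i) * V)%type.

(* [Ct] is the Howlett-Yin basis of M = H (x)_HJ E. *)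
Definition is_HY_basis (Ct : induced_vertex -> M) : Prop :=
  is_basis (Ct : induced_vertex -> amod H M) /\
  exists (barH : H -> H) (barE : E -> E) (barM : M -> M),
    [/\ is_hecke_bar barH, is_wgraph_bar barE,
        {morph barM : x y / x + y},
        forall h x, barM (tau h x) = tau (barH h) (barE x) &
        forall p, barM (Ct p) = Ct p /\
          uAminus_span
            ((fun q => tau (hecke_T H (val q.1)) (e q.2)) : induced_vertex -> amod H M)
            (Ct p - tau (hecke_T H (val p.1)) (e p.2))].

(* [Lam] is the W-graph induced from the W_J-graph [G], where E = A[G]. *)
Definition is_induced_wgraph (G : wgraph (cox_gen CJ) V)
    (Ct : induced_vertex -> M) (Lam : wgraph (cox_gen C) induced_vertex) : Prop :=
  [/\ wgraph_on e G, is_tensor iota tau, is_HY_basis Ct & wgraph_on Ct Lam].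

End Induction.

(* Main.v *)
(* Let D be the set of minimal length representatives x of the cosets W_J x in
   W_2.  As a left H_J-module H_2 is the direct sum of the H_J T_x, so the
   induced module is the direct sum over x in D of copies H_1 (x) T_x of H_1.
   The bar involution of H_2 is triangular for the length, bar T_x being T_x
   plus a combination of shorter T_y; hence the component of bar m at the
   longest x occurring in m is the bar of the component of m.

   Expand the Howlett-Yin basis vector attached to (w, v x) along this
   decomposition.  Its component at T_x is congruent to T_(wv), and its other
   components to 0, modulo u^-1 A^-.  If a component other than the one at x
   were nonzero at some x' at least as long as x, a longest such component would
   be bar-invariant in u^-1 A^-{T_w}, hence zero.  So x is the top component,
   and that component is bar-invariant, i.e. it is C'_(wv).

   Filter by a well-order of D refining the length: the projection onto
   H_1 (x) T_x identifies the layer of x, with its H_1-action, with the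
   Kazhdan-Lusztig basis of H_1, and descent sets, the relevant mu's and the
   preorder inside a layer are read off from the action.  A cell cannot meet two
   layers. *)
From Stdlib Require Import Relations.
Require Import Defs.
From HB Require Import structures.
From mathcomp Require Import all_boot all_algebra.
From mathcomp Require Import finmap boolp classical_sets.
From mathcomp Require Import cardinality fsbigop wochoice ring zify.

Import GRing.Theory.
Local Open Scope classical_set_scope.
Local Open Scope ring_scope.

Set Implicit Arguments.
Unset Strict Implicit.
Unset Printing Implicit Defensive.

(** * The ideal u^-1 Z[u^-1] *)

Section Uaminus.

Lemma uAminus0 : uAminus 0.
Proof. by exists 0; rewrite rmorph0 mulr0. Qed.

Lemma uAminusD a b : uAminus a -> uAminus b -> uAminus (a + b).
Proof. by move=> [p ->] [q ->]; exists (p + q); rewrite rmorphD mulrDr. Qed.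

Lemma uAminusN a : uAminus a -> uAminus (- a).
Proof. by move=> [p ->]; exists (- p); rewrite rmorphN mulrN. Qed.

Lemma uAminusM a b : uAminus a -> uAminus b -> uAminus (a * b).
Proof.
move=> [p ->] [q ->]; exists ('X * (p * q)).
by rewrite !rmorphM /= evalAX; ring.
Qed.

(** [q] is [p] with its coefficients reversed up to a power of [u]. The size bound feeds the degree
    count in [uAminus_bar_eq0]. *)
Lemma evalA_uinv_reverse (p : {poly int}) :
  exists n (q : {poly int}),
    (size q <= n.+1)%N /\ evalA uinv p = evalA u q * uinv ^+ n.
Proof.
elim/poly_ind: p => [|p c [n [q [sq qE]]]].
  by exists 0%N, 0; rewrite size_poly0 !rmorph0 mul0r.
exists n.+1, (q + c%:P * 'X ^+ n.+1); split.
  rewrite (leq_trans (size_polyD _ _)) // geq_max (leq_trans sq) //=.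
  by rewrite mul_polyC (leq_trans (size_scale_leq _ _)) // size_polyXn.
have cE a : evalA a c%:P = c%:~R.
  by rewrite -[c in LHS]intz -[LHS]/(evalA a (c%:~R)%:P) rmorph_int rmorph_int.
rewrite !rmorphD !rmorphM rmorphXn /= !evalAX qE !cE.
by rewrite mulrDl exprSr mulrA -[X in _ = _ + X]mulrA -exprSr un_uinvn mulr1.
Qed.

Lemma bar_uinv : bar uinv = u.
Proof.
by rewrite -[uinv]mul1r -[1](rmorph1 (evalA u)) -[uinv]expr1 bar_eval rmorph1 mul1r.
Qed.

Lemma bar_evalA a p : bar (evalA a p) = evalA (bar a) p.
Proof.
rewrite /evalA -horner_map -map_poly_comp.
by congr horner; apply: eq_map_poly => z /=; rewrite rmorph_int.
Qed.

(** Only negative powers of [u] occur in [a] and only positive ones in [bar a]. With denominators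
    cleared, invariance reads [p * 'X ^+ n.+2 = q], which the size of [q] allows only for
    [p = 0]. *)
Lemma uAminus_bar_eq0 a : uAminus a -> bar a = a -> a = 0.
Proof.
move=> [p aE] abar; have [n [q [sq qE]]] := evalA_uinv_reverse p.
have pq : p * 'X ^+ n.+2 = q.
  apply: evalAu_inj; rewrite evalAMXn.
  rewrite -[evalA u q]mulr1 -(un_uinvn n.+1).
  have -> : evalA u p * u ^+ n.+2 = (u * evalA u p) * u ^+ n.+1.
    by rewrite exprS; ring.
  have -> : u * evalA u p = uinv * evalA uinv p.
    by rewrite -aE -abar aE rmorphM /= bar_evalA bar_uinv.
  by rewrite qE !exprS; ring.
have [p0|p0] := eqVneq p 0; first by rewrite aE p0 rmorph0 mulr0.
by move: sq; rewrite -pq size_mulXn //; lia.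
Qed.

(** This is what lets the diagonal coefficient of C'_s detect whether [s] is a descent. *)
Lemma quantum2_neq0 : quantum2 != 0.
Proof.
apply/eqP => /(congr1 ( *%R u)); rewrite mulrDr u_uinv mulr0 => E.
have : evalA u ('X ^+ 2 + 1) = evalA u 0.
  by rewrite rmorphD rmorphXn /= evalAX rmorph1 rmorph0 expr2.
move/evalAu_inj/(congr1 (fun p : {poly int} => p`_0)).
by rewrite coefD coefXn coef1 coef0.
Qed.

End Uaminus.

(** * Coordinates *)

Section Coordinates.
Variables (V : choiceType) (M : lmodType laurent) (b : V -> M).

Lemma lincomb_fset (a : {fsfun V -> laurent with 0}) (r : {fset V}) :
  (finsupp a `<=` r)%fset -> lincomb b a = \sum_(x <- r) a x *: b x.
Proof.
move=> ar; apply/big_fset_incl => // x _ xa.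
by rewrite fsfun_dflt ?scale0r.
Qed.

Hypothesis hb : is_basis b.

Definition coordf (m : M) : {fsfun V -> laurent with 0} := sval (cid (hb m)).

Definition coord (m : M) (x : V) : laurent := coordf m x.

Lemma lincomb_coord m : lincomb b (coordf m) = m.
Proof. by case: (svalP (cid (hb m))). Qed.

Lemma coord_lincomb a : coordf (lincomb b a) = a.
Proof. by case: (svalP (cid (hb (lincomb b a)))) => _; apply. Qed.

Lemma coord_inj m m' : coord m =1 coord m' -> m = m'.
Proof. by move/fsfunP => E; rewrite -(lincomb_coord m) E lincomb_coord. Qed.

Lemma coord_sum (r : {fset V}) (F : V -> laurent) y :
  coord (\sum_(x <- r) F x *: b x) y = if y \in r then F y else 0.
Proof.
have -> : \sum_(x <- r) F x *: b x = lincomb b [fsfun x in r => F x].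
  rewrite (@lincomb_fset _ r); last first.
    by apply/fsubsetP => x; rewrite mem_finsupp fsfun_fun; case: ifP => //; rewrite eqxx.
  by apply: eq_big_seq => x xr; rewrite fsfun_fun xr.
by rewrite /coord coord_lincomb fsfun_fun.
Qed.

Lemma coord_dflt m x : x \notin finsupp (coordf m) -> coord m x = 0.
Proof. exact: fsfun_dflt. Qed.

Lemma coord_linear c m m' y :
  coord (c *: m + m') y = c * coord m y + coord m' y.
Proof.
pose r := (finsupp (coordf m) `|` finsupp (coordf m'))%fset.
have E n : (finsupp (coordf n) `<=` r)%fset -> n = \sum_(x <- r) coord n x *: b x.
  by move=> nr; rewrite -lincomb_fset // lincomb_coord.
have -> : c *: m + m' = \sum_(x <- r) (c * coord m x + coord m' x) *: b x.
  rewrite {1}(E m) ?fsubsetUl // {1}(E m') ?fsubsetUr // scaler_sumr -big_split.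
  by apply: eq_bigr => x _; rewrite scalerDl scalerA.
rewrite coord_sum; case: ifPn => //; rewrite in_fsetU negb_or => /andP[h h'].
by rewrite !coord_dflt // mulr0 addr0.
Qed.

Lemma coordD m m' y : coord (m + m') y = coord m y + coord m' y.
Proof. by rewrite -{1}[m]scale1r coord_linear mul1r. Qed.

Lemma coord0 y : coord 0 y = 0.
Proof. by apply: (addrI (coord 0 y)); rewrite -coordD !addr0. Qed.

Lemma coordZ c m y : coord (c *: m) y = c * coord m y.
Proof. by rewrite -[c *: m]addr0 coord_linear coord0 addr0. Qed.

Lemma coordB m m' y : coord (m - m') y = coord m y - coord m' y.
Proof. by rewrite -scaleN1r coordD coordZ mulN1r. Qed.

Lemma coord_basis x y : coord (b x) y = (y == x)%:R.
Proof.
have -> : b x = \sum_(z <- [fset x]%fset) 1 *: b z by rewrite big_seq_fset1 scale1r.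
by rewrite (coord_sum _ (fun=> 1)) inE; case: ifP.
Qed.

Lemma basis_ind (P : M -> Prop) :
  P 0 -> (forall m m', P m -> P m' -> P (m + m')) ->
  (forall c x, P (c *: b x)) -> forall m, P m.
Proof.
by move=> P0 PD Pb m; rewrite -(lincomb_coord m); apply: big_ind => // x _.
Qed.

Lemma coord_neq0 m : m != 0 -> exists x, coord m x != 0.
Proof.
move=> /negP m0; apply: contrapT => /forallNP nex; apply: m0; apply/eqP.
by apply: coord_inj => x; rewrite coord0; move/negP: (nex x); rewrite negbK => /eqP.
Qed.

Lemma span_ofP (X : set V) m :
  span_of b X m <-> forall x, coord m x != 0 -> X x.
Proof.
split=> [[a aX ->] x|mX]; first by rewrite /coord coord_lincomb => /aX.
by exists (coordf m) => //; rewrite lincomb_coord.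
Qed.

Lemma occursP x m : occurs b x m <-> coord m x != 0.
Proof.
split=> [[a -> ax]|mx]; first by rewrite /coord coord_lincomb.
by exists (coordf m) => //; rewrite lincomb_coord.
Qed.

Lemma uAminus_spanP m : uAminus_span b m <-> forall x, uAminus (coord m x).
Proof.
split=> [[a aA ->] x|mA]; first by rewrite /coord coord_lincomb.
by exists (coordf m) => //; rewrite lincomb_coord.
Qed.

(** Applied with [sigma := bar] to identify bar involutions that agree on a basis. *)
Lemma semilinear_eq (N : lmodType laurent) (sigma : laurent -> laurent)
    (f g : M -> N) :
  {morph f : x y / x + y} -> {morph g : x y / x + y} ->
  (forall a x, f (a *: x) = sigma a *: f x) ->
  (forall a x, g (a *: x) = sigma a *: g x) ->
  (forall x, f (b x) = g (b x)) -> f =1 g.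
Proof.
move=> fD gD fZ gZ fg; apply: basis_ind => [|m m' E E'|c x].
- have h0 (h : M -> N) : {morph h : x y / x + y} -> h 0 = 0.
    by move=> hD; apply: (addrI (h 0)); rewrite -hD !addr0.
  by rewrite !h0.
- by rewrite fD gD E E'.
- by rewrite fZ gZ fg.
Qed.

Section Extension.
Variables (N : lmodType laurent) (g : V -> N).

Definition basis_ext (m : M) : N :=
  \sum_(x <- finsupp (coordf m)) coord m x *: g x.

Lemma basis_ext_fset m (r : {fset V}) : (finsupp (coordf m) `<=` r)%fset ->
  basis_ext m = \sum_(x <- r) coord m x *: g x.
Proof.
by move=> mr; apply/big_fset_incl => // x _ xm; rewrite coord_dflt ?scale0r.
Qed.

Fact basis_ext_linear : linear basis_ext.
Proof.
move=> c m m'.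
(* One finite set containing all three supports, so that the three sums share their index set. *)
pose r := (finsupp (coordf m) `|` finsupp (coordf m') `|`
           finsupp (coordf (c *: m + m')))%fset.
have r1 : (finsupp (coordf m) `<=` r)%fset by rewrite /r -fsetUA fsubsetUl.
have r2 : (finsupp (coordf m') `<=` r)%fset.
  by rewrite /r [(finsupp (coordf m) `|` _)%fset]fsetUC -fsetUA fsubsetUl.
have r3 : (finsupp (coordf (c *: m + m')) `<=` r)%fset by rewrite fsubsetUr.
rewrite (basis_ext_fset r1) (basis_ext_fset r2) (basis_ext_fset r3).
rewrite scaler_sumr -big_split; apply: eq_bigr => x _.
by rewrite coord_linear scalerDl scalerA.
Qed.

HB.instance Definition _ :=
  GRing.isLinear.Build laurent M N *:%R basis_ext basis_ext_linear.

Lemma basis_extE x : basis_ext (b x) = g x.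
Proof.
have s : (finsupp (coordf (b x)) `<=` [fset x])%fset.
  apply/fsubsetP => y; rewrite mem_finsupp -/(coord (b x) y) coord_basis inE.
  by case: (y == x) => //; rewrite eqxx.
by rewrite (basis_ext_fset s) big_seq_fset1 coord_basis eqxx scale1r.
Qed.

End Extension.

End Coordinates.

(** * Coxeter groups *)

Section Exchange.
Variable C : coxeterSystem.
Implicit Types (s : cox_gen C) (k l : seq (cox_gen C)) (t v w x : C).

Definition wprod l : C := (\prod_(s <- l) refl s)%g.

Lemma wprod_nil : wprod [::] = 1%g.
Proof. by rewrite /wprod big_nil. Qed.

Lemma wprod_cons s l : wprod (s :: l) = (refl s * wprod l)%g.
Proof. by rewrite /wprod big_cons. Qed.

Lemma wprod_cat k l : wprod (k ++ l) = (wprod k * wprod l)%g.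
Proof. by rewrite /wprod big_cat. Qed.

Lemma wprod1 s : wprod [:: s] = refl s.
Proof. by rewrite wprod_cons wprod_nil mulg1. Qed.

Lemma refl_sq s : (refl s * refl s)%g = 1%g.
Proof.
have /cox_presented := @cox_equiv_rel _ (@cox_mx C) s s.
have /eqP-> : cox_mx s s == 1%N by rewrite cox_mx_eq1.
by rewrite -[LHS]/(wprod [:: s; s]) wprod_cons wprod1 big_nil.
Qed.

Lemma reflV s : ((refl s)^-1)%g = refl s.
Proof. by apply/esym/eqP; rewrite -mulg_eq1 refl_sq. Qed.

(* Parity of the number of positions [j] for which [t] is the reflection
   s_1 .. s_(j-1) s_j s_(j-1) .. s_1 attached to the word [l]. *)
Fixpoint refl_parity l t : bool :=
  if l is s :: l' then (t == refl s) (+) refl_parity l' (refl s * t * refl s)%g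
  else false.

(** The reflections attached to [k ++ l] are those of [k], followed by those of [l] conjugated by
    [wprod k]. *)
Lemma refl_parity_cat k l t :
  refl_parity (k ++ l) t =
  refl_parity k t (+) refl_parity l ((wprod k)^-1 * t * wprod k)%g.
Proof.
elim: k t => [|s k IH] t /=; first by rewrite wprod_nil invg1 mul1g mulg1.
by rewrite IH addbA wprod_cons invgM reflV !mulgA.
Qed.

(** The first two reflections are s and s t s = c s; the remaining ones are those of the shorter
    word conjugated by c. *)
Lemma refl_parity_braid s (t : cox_gen C) n x :
  let c := (refl s * refl t)%g in
  refl_parity (flatten (nseq n [:: s; t])) x =
  \big[addb/false]_(0 <= j < n.*2) (x == c ^+ j * refl s)%g.
Proof.
move=> c; elim: n x => [|n IH] x /=; first by rewrite big_nil.
have cV : (c^-1 = refl t * refl s)%g by rewrite invgM !reflV.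
rewrite IH doubleS big_nat_recl // big_nat_recl //= expg0 mul1g expg1.
congr (_ (+) (_ (+) _)).
  rewrite -(inj_eq (mulIg (refl s))) -(inj_eq (mulgI (refl s))).
  by rewrite !mulgA refl_sq mul1g -mulgA refl_sq mulg1.
(* Conjugation by c takes c^j s to c^(j+2) s, because s c^-1 = c s. *)
apply: eq_bigr => j _.
rewrite -(inj_eq (mulIg (refl t))) -(inj_eq (mulgI (refl t))).
rewrite -(inj_eq (mulIg (refl s))) -(inj_eq (mulgI (refl s))).
have -> : (refl s * (refl t * (refl t * (refl s * x * refl s) * refl t * refl t) *
  refl s) = x)%g.
  rewrite !mulgA -[(_ * refl t * refl t)%g]mulgA refl_sq mulg1.
  rewrite -[(refl s * refl t * refl t)%g]mulgA refl_sq mulg1 refl_sq mul1g.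
  by rewrite -mulgA refl_sq mulg1.
by rewrite expgS expgSr /c !mulgA.
Qed.

(** The parity descends from words to group elements; this is where the Coxeter presentation enters.
    Concatenation is handled by the cocycle rule [refl_parity_cat]. *)
Lemma refl_parity_equiv l l' :
  cox_equiv (@cox_mx C) l l' -> refl_parity l =1 refl_parity l'.
Proof.
elim=> {l l'} [s t|l|l l' _ IH|l l' l'' _ IH _ IH'|k k' l l' kk' IH _ IH'] x //.
- set m := cox_mx s t; set c := (refl s * refl t)%g.
  have cm : (c ^+ m = 1)%g.
    have /cox_presented := cox_equiv_rel (@cox_mx C) s t.
    rewrite big_nil -/m -[LHS]/(wprod _) => <-.
    elim: m => [|m IH]; first by rewrite wprod_nil.
    by rewrite expgS IH /= !wprod_cons mulgA.
  (* Since c^m = 1, positions j and j + m carry the same reflection, so the two halves cancel modulo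
     2. *)
  rewrite refl_parity_braid -addnn (big_cat_nat (n := m)) ?leq_addr //=.
  rewrite -{2}[m]add0n big_addn addnK.
  rewrite [X in _ (+) X](eq_bigr (fun j => x == c ^+ j * refl s)%g) ?addbb //.
  by move=> j _; rewrite expgnDr cm mulg1.
- by rewrite IH IH'.
- rewrite !refl_parity_cat IH IH'.
  by have /cox_presented kk'E := kk'; rewrite /wprod kk'E.
Qed.

Lemma refl_parity_wprod l l' : wprod l = wprod l' -> refl_parity l =1 refl_parity l'.
Proof. by move/cox_presented; exact: refl_parity_equiv. Qed.

(** Odd parity means that [t] is the reflection at some position; left multiplication by [t] then
    deletes the letter there. *)
Lemma refl_parity_deletion l t : refl_parity l t ->
  exists m, (size (mask m l) < size l)%N /\ (t * wprod l)%g = wprod (mask m l).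
Proof.
elim: l t => [//|s l IH] t /=; case: eqP => [->|_] /=.
  move=> _; exists (false :: nseq (size l) true).
  by rewrite /= mask_true // wprod_cons mulgA refl_sq mul1g.
move/IH => [m [ml mE]]; exists (true :: m); split=> //=.
by rewrite !wprod_cons -mE !mulgA refl_sq mul1g.
Qed.

Lemma cox_length_wprod l : (cox_length (wprod l) <= size l)%N.
Proof. by rewrite /cox_length; case: ex_minnP => n _; apply; apply/asboolP; exists l. Qed.

Lemma reduced_word w : exists2 l, size l = cox_length w & wprod l = w.
Proof. by rewrite /cox_length; case: ex_minnP => n /asboolP[l <- ->] _; exists l. Qed.

Lemma cox_length1 : cox_length (1%g : C) = 0%N.
Proof. by apply/eqP; rewrite -leqn0 -wprod_nil cox_length_wprod. Qed.

Lemma cox_length_eq0 w : cox_length w = 0%N -> w = 1%g.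
Proof.
by case: (reduced_word w) => l <- <- /size0nil ->; rewrite wprod_nil.
Qed.

Lemma cox_length_mul v w : (cox_length (v * w)%g <= cox_length v + cox_length w)%N.
Proof.
have [k <- <-] := reduced_word v; have [l <- <-] := reduced_word w.
by rewrite -wprod_cat -size_cat cox_length_wprod.
Qed.

Lemma wprod_rev l : wprod (rev l) = ((wprod l)^-1)%g.
Proof.
elim: l => [|s l IH]; first by rewrite wprod_nil invg1.
by rewrite rev_cons -cats1 wprod_cat wprod1 wprod_cons IH invgM reflV.
Qed.

Lemma cox_lengthV w : cox_length (w^-1)%g = cox_length w.
Proof.
have lV v : (cox_length (v^-1)%g <= cox_length v)%N.
  by have [l <- <-] := reduced_word v; rewrite -wprod_rev -(size_rev l) cox_length_wprod.
by apply/eqP; rewrite eqn_leq lV -{1}[w]invgK lV.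
Qed.

Lemma cox_length_refl s : (cox_length (refl s) <= 1)%N.
Proof. by rewrite -wprod1 cox_length_wprod. Qed.

(** Stated through parity rather than as a deletion, so that for a word [k ++ l] the letter to be
    deleted can be located in [k] or in [l] by [refl_parity_cat]. *)
Lemma exchange l s :
  (cox_length (wprod l * refl s)%g <= cox_length (wprod l))%N ->
  refl_parity l (wprod l * refl s * (wprod l)^-1)%g.
Proof.
set w := wprod l; set t := (_ * _^-1)%g => lws; apply: contraT => nt.
have tw : (t * w = w * refl s)%g by rewrite /t mulgVK.
have tt : (t * t = 1)%g.
  by rewrite /t !mulgA mulgVK -[(w * _ * _)%g]mulgA refl_sq mulg1 mulgV.
(* If t were even for w it would be odd for w s = t w, so multiplying w s by t
   would give w, shorter than w s. *)
have [k sk kE] := reduced_word (w * refl s)%g.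
have : refl_parity k t.
  have -> : refl_parity k t = refl_parity (l ++ [:: s]) t.
    by apply: refl_parity_wprod; rewrite kE wprod_cat wprod1.
  rewrite refl_parity_cat (negbTE nt) /= addbF -/w.
  by rewrite -mulgA tw mulKg eqxx.
case/refl_parity_deletion => m [mk]; rewrite kE -tw mulgA tt mul1g => wE.
by have := cox_length_wprod (mask m k); rewrite -wE; lia.
Qed.

(** Each length exceeds the other by at most one. Equality is impossible: exchange would delete a
    letter from a reduced word of [w] and make [w s] strictly shorter. *)
Lemma cox_length_mulr w s :
  cox_length (w * refl s)%g = (cox_length w).+1 \/
  cox_length w = (cox_length (w * refl s)%g).+1.
Proof.
have l1 : (cox_length (w * refl s)%g <= (cox_length w).+1)%N.
  by rewrite (leq_trans (cox_length_mul _ _)) // -addn1 leq_add2l cox_length_refl.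
have l2 : (cox_length w <= (cox_length (w * refl s)%g).+1)%N.
  have {1}-> : w = (w * refl s * refl s)%g by rewrite -mulgA refl_sq mulg1.
  by rewrite (leq_trans (cox_length_mul _ _)) // -addn1 leq_add2l cox_length_refl.
have [lt|le] := ltnP (cox_length w) (cox_length (w * refl s)%g); [left|right]; first lia.
have [l sl lE] := reduced_word w; move: le; rewrite -lE => /exchange.
case/refl_parity_deletion => m [ml]; rewrite mulgVK lE => E.
by have := cox_length_wprod (mask m l); rewrite -E; lia.
Qed.

Lemma cox_length_mull s w :
  cox_length (refl s * w)%g = (cox_length w).+1 \/
  cox_length w = (cox_length (refl s * w)%g).+1.
Proof.
by have := cox_length_mulr (w^-1)%g s; rewrite -[refl s]reflV -invgM !cox_lengthV reflV.
Qed.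

Lemma cox_length_ind (P : C -> Prop) : P 1%g ->
  (forall s w, cox_length (refl s * w)%g = (cox_length w).+1 -> P w ->
     P (refl s * w)%g) ->
  forall w, P w.
Proof.
move=> P1 PS w; have [n] := ubnP (cox_length w).
elim: n w => // n IH w ln; have [l sl lE] := reduced_word w.
case: l sl lE => [|s l] sl lE; first by rewrite -lE wprod_nil.
rewrite wprod_cons in lE; rewrite -lE; have ll := cox_length_wprod l.
have lw : (cox_length w <= (cox_length (wprod l)).+1)%N.
  by rewrite -lE; case: (cox_length_mull s (wprod l)); lia.
by apply: PS; [rewrite lE; move: sl lw ll => /=; lia|apply: IH; move: sl => /=; lia].
Qed.

End Exchange.

(** * Parabolic subgroups and minimal coset representatives *)

Section Parabolic.
Variables (CJ C : coxeterSystem) (i : cox_gen CJ -> cox_gen C) (f : CJ -> C).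
Hypothesis hf : parabolic_iso i f.
Local Notation WJ := (parabolic (range i)).
Local Notation reps := (min_reps (range i)).

Lemma parab_mul : {morph f : x y / (x * y)%g}.
Proof. by case: hf. Qed.

Lemma parab_inj : injective f.
Proof. by case: hf. Qed.

Lemma parab1 : f 1%g = 1%g.
Proof. by apply: (mulgI (f 1%g)); rewrite -parab_mul !mulg1. Qed.

Lemma parabV v : f (v^-1)%g = ((f v)^-1)%g.
Proof. by apply/esym/mulg1_eq; rewrite -parab_mul mulgV parab1. Qed.

Lemma parab_wprod l : f (wprod l) = wprod (map i l).
Proof.
case: hf => _ _ _ _ fs.
elim: l => [|s l IH] /=; first by rewrite !wprod_nil parab1.
by rewrite !wprod_cons parab_mul IH fs.
Qed.

Lemma parabolicP w : WJ w <-> exists v, w = f v.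
Proof.
case: hf => _ _ _ <- _; split=> [[v _ <-]|[v ->]]; first by exists v.
by exists v.
Qed.

Lemma min_rep_le w v : reps w -> (cox_length w <= cox_length (w * f v)%g)%N.
Proof. by apply; apply/parabolicP; exists v. Qed.

(** Append the letters of a reduced word of [v] one by one. If the length failed to grow, exchange
    would delete an earlier letter: one in the word of [w] contradicts minimality in the coset, one
    in the word of [v] contradicts reducedness. *)
Lemma min_rep_lengthJ w v : reps w ->
  cox_length (w * f v)%g = (cox_length w + cox_length v)%N.
Proof.
move=> mw; have [n] := ubnP (cox_length v); elim: n v => // n IH v lv.
have [l] := reduced_word v; case/lastP: l => [|l s] sl lE.
  by move: sl; rewrite -lE wprod_nil parab1 mulg1 /= => <-; rewrite addn0.
pose v' := wprod l; have vE : v = (v' * refl s)%g by rewrite -lE -cats1 wprod_cat wprod1.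
rewrite size_rcons in sl; have lv' := cox_length_wprod l.
have {}lv' : cox_length v = (cox_length v').+1.
  by move: lv'; rewrite vE; case: (cox_length_mulr v' s) => //; rewrite -/v' -vE; lia.
have {}IH : cox_length (w * f v')%g = (cox_length w + cox_length v')%N by apply: IH; lia.
have fs : f (refl s) = refl (i s) by case: hf.
have wvE : (w * f v = w * f v' * refl (i s))%g by rewrite vE parab_mul fs mulgA.
have [k sk kE] := reduced_word w.
have kl : wprod (k ++ map i l) = (w * f v')%g by rewrite wprod_cat kE parab_wprod.
case: (cox_length_mulr (w * f v')%g (i s)) => [|lt]; first by rewrite -wvE IH lv'; lia.
have := @exchange _ (k ++ map i l) (i s); rewrite kl => /(_ _)/wrap[]; first by lia.
rewrite refl_parity_cat; case pk: (refl_parity k _) => /=.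
  move=> _; case/refl_parity_deletion: pk => m [mk]; rewrite kE => E.
  (* Deletion inside [k] yields a shorter element of the coset of [w], namely [w] times the
     conjugate of [s] by [v']. *)
  have := @min_rep_le w (v' * refl s * v'^-1)%g mw.
  have -> : (w * f (v' * refl s * v'^-1) = wprod (mask m k))%g.
    rewrite -E !parab_mul parabV fs invgM !mulgA.
    by rewrite mulgVK.
  by have := cox_length_wprod (mask m k); lia.
case/refl_parity_deletion => m [ml]; rewrite -map_mask -!parab_wprod -/v' kE.
rewrite invgM !mulgA mulVg mul1g mulgVK mulgVK -fs -parab_mul => /parab_inj.
rewrite -vE => vE'; have := cox_length_wprod (mask m l); rewrite -vE'.
by move: ml; rewrite -map_mask !size_map; lia.
Qed.

(** The case [w = 1] of [min_rep_lengthJ]. *)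
Lemma parab_length v : cox_length (f v) = cox_length v.
Proof.
rewrite -[f v]mul1g min_rep_lengthJ ?cox_length1 // => x _.
by rewrite cox_length1.
Qed.

Lemma min_rep_length w v : reps w ->
  cox_length (w * f v)%g = (cox_length w + cox_length (f v))%N.
Proof. by move=> mw; rewrite parab_length min_rep_lengthJ. Qed.

Lemma min_rep_decomp w : exists y v, reps y /\ w = (y * f v)%g.
Proof.
have ex : exists n, `[< exists v, cox_length (w * f v)%g = n >].
  by exists (cox_length (w * f 1%g)%g); apply/asboolP; exists 1%g.
case: (ex_minnP ex) => n /asboolP[v vn] nmin.
exists (w * f v)%g, (v^-1)%g; split; last by rewrite parabV mulgK.
move=> x /parabolicP[v' ->]; rewrite vn; apply: nmin; apply/asboolP.
by exists (v * v')%g; rewrite parab_mul mulgA.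
Qed.

(** Write [y = y' * f a]. Additivity gives [y] the length of [y'] plus that of [f a], while
    minimality of [y] bounds it by that of [y']; hence [f a = 1]. *)
Lemma min_rep_uniq y y' v v' : reps y -> reps y' ->
  (y * f v)%g = (y' * f v')%g -> y = y' /\ v = v'.
Proof.
move=> ry ry' E; have yE : y = (y' * f (v' * v^-1))%g.
  by rewrite parab_mul parabV mulgA -E mulgK.
have := min_rep_le (v * v'^-1)%g ry.
have -> : (y * f (v * v'^-1) = y')%g by rewrite parab_mul parabV mulgA E mulgK.
rewrite {1}yE min_rep_length // => le.
have /cox_length_eq0 f1 : cox_length (f (v' * v^-1)%g) = 0%N by lia.
have yy : y = y' by rewrite yE f1 mulg1.
by split=> //; move: E; rewrite yy => /mulgI/parab_inj.
Qed.

(** Inversion carries the facts on cosets w W_J over to the cosets W_J x, here and in the next two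
    lemmas. *)
Lemma min_repV_length x v : reps (x^-1)%g ->
  cox_length (f v * x)%g = (cox_length (f v) + cox_length x)%N.
Proof.
move=> rx; rewrite -cox_lengthV invgM -parabV min_rep_length // parabV !cox_lengthV.
by rewrite addnC.
Qed.

Lemma min_repV_decomp z : exists v x, reps (x^-1)%g /\ z = (f v * x)%g.
Proof.
have [y [v [ry E]]] := min_rep_decomp (z^-1)%g.
exists (v^-1)%g, (y^-1)%g; rewrite invgK; split=> //.
by rewrite parabV -invgM -E invgK.
Qed.

Lemma min_repV_uniq x x' v v' : reps (x^-1)%g -> reps (x'^-1)%g ->
  (f v * x)%g = (f v' * x')%g -> x = x' /\ v = v'.
Proof.
move=> rx rx' /(congr1 (fun z => z^-1)%g); rewrite !invgM -!parabV.
by case/min_rep_uniq => // /invg_inj -> /invg_inj ->.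
Qed.

End Parabolic.

(** * Hecke algebras *)

Lemma coord_big (V : choiceType) (M : lmodType laurent) (b : V -> M)
    (hb : is_basis b) (I : Type) (r : seq I) (F : I -> M) y :
  coord hb (\sum_(j <- r) F j) y = \sum_(j <- r) coord hb (F j) y.
Proof.
by apply: (big_morph (fun m => coord hb m y)) => [m m'|]; rewrite ?coordD ?coord0.
Qed.

(** Supplies top terms of finite supports, both for lengths and for the well-order on layers. *)
Lemma seq_max_key (I : eqType) (K : Type) (R : rel K) (key : I -> K) (r : seq I) x :
  total R -> transitive R -> x \in r ->
  exists2 y, y \in r & forall z, z \in r -> R (key z) (key y).
Proof.
move=> Rtot Rtr; have Rxx k : R k k by have := Rtot k k; rewrite orbb.
elim: r x => // a [_ x _|b r IH x _].
  by exists a; rewrite ?mem_head // => z; rewrite inE => /eqP->.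
have [y yr ymax] := IH b (mem_head _ _).
have /orP[ya|ay] := Rtot (key y) (key a).
  exists a; first exact: mem_head.
  by move=> z; rewrite inE => /predU1P[->//|/ymax zy]; apply: Rtr ya.
exists y; first by rewrite inE yr orbT.
by move=> z; rewrite inE => /predU1P[->|/ymax].
Qed.

Section Hecke.
Variables (C : coxeterSystem) (H : heckeAlgebra C).
Local Notation T := (hecke_T H).
Local Notation hb := (@hecke_T_basis C H).
Local Notation q := (u - uinv).

Lemma hecke_T1 : T 1%g = 1.
Proof.
have T1l : forall h : H, T 1%g * h = h.
  apply: (basis_ind hb) => [|m m' E E'|c x].
    by rewrite mulr0.
    by rewrite mulrDr E E'.
  by rewrite -scalerAr hecke_T_mul mul1g ?cox_length1.
by rewrite -[LHS]mulr1 T1l.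
Qed.

Lemma hecke_T_sq s : T (refl s) * T (refl s) = q *: T (refl s) + 1.
Proof.
have := hecke_T_quad H s; rewrite mulrDr !mulrBl -!scalerAr -!scalerAl !mulr1 !mul1r.
rewrite scalerA [uinv * u]mulrC u_uinv scale1r => /eqP.
by rewrite -addrA addr_eq0 => /eqP ->; rewrite !opprD !opprK scalerBl addrA.
Qed.

(** If the length drops, [T w] is T_s T_(sw) and the quadratic relation applies. *)
Lemma hecke_T_mull s w : T (refl s) * T w =
  if (cox_length w < cox_length (refl s * w)%g)%N then T (refl s * w)%g
  else q *: T w + T (refl s * w)%g.
Proof.
have TsT v : cox_length (refl s * v)%g = (cox_length v).+1 ->
    T (refl s) * T v = T (refl s * v)%g.
  move=> E; apply: hecke_T_mul; rewrite E; apply/eqP.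
  have := cox_length_mul (refl s) v; have := cox_length_refl s; lia.
case: (cox_length_mull s w) => E.
  by rewrite E ltnS leqnn TsT.
rewrite ltnNge {1}E leqnSn /=.
have wE : w = (refl s * (refl s * w))%g by rewrite mulgA refl_sq mul1g.
have <- : T (refl s) * T (refl s * w)%g = T w by rewrite TsT -?wE.
by rewrite mulrA hecke_T_sq mulrDl mul1r scalerAl.
Qed.

(** Length serves as the triangularity order, in place of the Bruhat order. *)
Definition shorter n (h : H) := forall y, coord hb h y != 0 -> (cox_length y < n)%N.

Lemma shorterP n h :
  shorter n h <-> forall y, (n <= cox_length y)%N -> coord hb h y = 0.
Proof.
split=> [hn y|hn y]; first by rewrite leqNgt; apply: contraNeq => /hn.
by rewrite ltnNge; apply: contraNN => /hn ->.
Qed.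

Lemma shorterD n h h' : shorter n h -> shorter n h' -> shorter n (h + h').
Proof.
move=> /shorterP hn /shorterP hn'; apply/shorterP => y ny.
by rewrite coordD hn ?hn' // addr0.
Qed.

Lemma shorterZ n c h : shorter n h -> shorter n (c *: h).
Proof. by move=> /shorterP hn; apply/shorterP => y ny; rewrite coordZ hn // mulr0. Qed.

Lemma shorter_T n w : (cox_length w < n)%N -> shorter n (T w).
Proof. by move=> wn y; rewrite coord_basis; case: (y =P w) => [->|]; rewrite ?eqxx. Qed.

Lemma shorterW m n h : (m <= n)%N -> shorter m h -> shorter n h.
Proof. by move=> mn hm y /hm ym; apply: leq_trans mn. Qed.

Lemma shorter_sum n h : shorter n h ->
  forall (P : H -> Prop), P 0 -> (forall x y, P x -> P y -> P (x + y)) ->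
  (forall c w, (cox_length w < n)%N -> P (c *: T w)) -> P h.
Proof.
move=> hn P P0 PD PT; rewrite -(lincomb_coord hb h) /lincomb big_seq.
apply: big_ind => // x xh; apply: PT; apply: hn.
by rewrite /coord -mem_finsupp.
Qed.

Lemma shorter_mull n s h : shorter n h -> shorter n.+1 (T (refl s) * h).
Proof.
move=> hn.
apply: (shorter_sum hn (P := fun h => shorter n.+1 (T (refl s) * h))) => [|x y|c w wn].
- by rewrite mulr0; apply/shorterP => y _; rewrite coord0.
- by rewrite mulrDr; exact: shorterD.
- rewrite -scalerAr; apply: shorterZ; rewrite hecke_T_mull.
  case: (cox_length_mull s w) => E; rewrite E.
    by rewrite ltnS leqnn; apply: shorter_T; rewrite E.
  rewrite ltnNge leqnSn /=; apply: shorterD; first apply: shorterZ.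
    by apply: shorter_T; rewrite ltnW.
  by apply: shorter_T; lia.
Qed.

(** * Triangularity of the bar involution and uniqueness of Kazhdan-Lusztig elements *)

Section Bar.
Variables (barH : H -> H) (hbar : is_hecke_bar barH).

Lemma hecke_bar0 : barH 0 = 0.
Proof. by case: hbar => barD _ _; apply: (addrI (barH 0)); rewrite -barD !addr0. Qed.

Lemma hecke_bar_sum (I : Type) (r : seq I) (F : I -> H) :
  barH (\sum_(j <- r) F j) = \sum_(j <- r) barH (F j).
Proof. by case: hbar => barD _ _; apply: (big_morph barH barD hecke_bar0). Qed.

(** [is_hecke_bar] describes bar T_w as the inverse of T_(w^-1), not through multiplicativity. The
    value at [s w] therefore comes from inverting T_(w^-1) T_s. *)
Lemma hecke_bar_T w : shorter (cox_length w) (barH (T w) - T w).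
Proof.
case: hbar => _ _ barT; elim/cox_length_ind: w => [|s w sw IH].
  have [] := barT 1%g; rewrite invg1 hecke_T1 mulr1 => -> _.
  by rewrite subrr => y; rewrite coord0 eqxx.
(* The first factor is the inverse of T_s. *)
pose X := (T (refl s) - q%:A) * barH (T w).
have sE : T (refl s) * (T (refl s) - q%:A) = 1.
  by rewrite mulrBr hecke_T_sq -scalerAr mulr1 addrC addKr.
have TwV : T ((refl s * w)^-1)%g = T (w^-1)%g * T (refl s).
  rewrite invgM reflV hecke_T_mul // -[refl s in LHS]reflV -invgM !cox_lengthV sw.
  by have := cox_length_mul (refl s) w; have := cox_length_refl s; rewrite sw; lia.
have -> : barH (T (refl s * w)%g) = X.
  have [b1 _] := barT (refl s * w)%g; have [_ b2] := barT w.
  have TX : T ((refl s * w)^-1)%g * X = 1.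
    by rewrite TwV /X mulrA -[_ * _ * (_ - _)]mulrA sE mulr1 b2.
  by rewrite -[LHS]mulr1 -TX mulrA b1 mul1r.
have -> : X - T (refl s * w)%g =
    T (refl s) * (barH (T w) - T w) - q *: ((barH (T w) - T w) + T w).
  rewrite subrK mulrBr hecke_T_mull sw ltnS leqnn /X mulrBl addrAC.
  by rewrite -scalerAl mul1r.
rewrite -scaleNr sw; apply: shorterD; first exact: shorter_mull.
apply/shorterZ/shorterD; first exact: shorterW IH.
exact: shorter_T.
Qed.

(** By triangularity, a basis element no longer than [w] and different from it contributes nothing
    at [w]. *)
Lemma hecke_bar_top h w :
  (forall y, coord hb h y != 0 -> (cox_length y <= cox_length w)%N) ->
  coord hb (barH h) w = bar (coord hb h w).
Proof.
move=> hw; case: (hbar) => _ barZ _.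
rewrite -{1}(lincomb_coord hb h) /lincomb hecke_bar_sum coord_big.
transitivity (\sum_(y <- finsupp (coordf hb h)) bar (coord hb h y) * (w == y)%:R).
  apply: eq_big_seq => y; rewrite mem_finsupp => /hw yw.
  rewrite barZ coordZ -[barH (T y)](subrK (T y)) coordD coord_basis.
  by have /shorterP -> := @hecke_bar_T y; rewrite ?add0r.
case: (boolP (w \in finsupp (coordf hb h))) => wh; last first.
  rewrite [in RHS]/coord fsfun_dflt // rmorph0 big_seq big1 // => y yh.
  by case: eqP => [wy|_]; rewrite ?mulr0 //; rewrite wy yh in wh.
rewrite (big_fsetD1 w) //= eqxx mulr1 big_seq big1 ?addr0 // => y.
by rewrite !inE eq_sym => /andP[/negbTE -> _]; rewrite mulr0.
Qed.

(** At a longest element of the support the coefficient is itself bar-invariant, hence zero by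
    [uAminus_bar_eq0]. *)
Lemma hecke_bar_invariant_eq0 h :
  barH h = h -> (forall w, uAminus (coord hb h w)) -> h = 0.
Proof.
move=> hh hA; apply: contrapT => /eqP/(coord_neq0 hb)[w0 w0h].
have [] := @seq_max_key _ _ leq (@cox_length C) (finsupp (coordf hb h)) w0
  leq_total leq_trans.
  by rewrite mem_finsupp.
move=> w; rewrite mem_finsupp -/(coord hb h w) => wh wmax.
have : coord hb h w = 0.
  apply: uAminus_bar_eq0 => //; rewrite -hecke_bar_top ?hh // => y yh.
  by apply: wmax; rewrite mem_finsupp.
by move/eqP; rewrite (negbTE wh).
Qed.

(** Inverses are unique. This reconciles the bar maps that the Kazhdan-Lusztig and Howlett-Yin
    predicates each quantify existentially. *)
Lemma hecke_bar_unique barH' : is_hecke_bar barH' -> barH' =1 barH.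
Proof.
case: (hbar) => barD barZ barT [barD' barZ' barT'].
apply: (semilinear_eq hb barD' barD barZ' barZ) => w.
have [b1 _] := barT' w; have [_ b2] := barT w.
by rewrite -[LHS]mulr1 -b2 mulrA b1 mul1r.
Qed.

Lemma KL_basis_unique KL : is_KL_basis KL -> forall h w,
  barH h = h -> (forall x, uAminus (coord hb (h - T w) x)) -> h = KL w.
Proof.
case=> _ [barH' /hecke_bar_unique barE KLp] h w hh hA; have [KLb KLT] := KLp w.
apply/eqP; rewrite -subr_eq0; apply/eqP/hecke_bar_invariant_eq0.
  case: hbar => barD barZ _.
  by rewrite -scaleN1r barD barZ rmorphN rmorph1 hh -barE KLb.
move=> x; have -> : h - KL w = (h - T w) - (KL w - T w).
  by rewrite opprB addrA subrK.
rewrite coordB; apply: uAminusD => //; apply: uAminusN.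
by have /(uAminus_spanP hb) := KLT; apply.
Qed.

End Bar.
End Hecke.

(** * Well-orders and W-graphs *)

Section WellOrder.
Variables (I : eqType) (R : rel I).
Hypothesis Rwo : well_order R.

Lemma well_order_chain : wo_chain R predT.
Proof. by move=> A _; apply: Rwo. Qed.

Lemma well_order_total : total R.
Proof. by move=> x y; apply: (wo_chainW well_order_chain). Qed.

Lemma well_order_anti : antisymmetric R.
Proof. by move=> x y; apply: (wo_chain_antisymmetric well_order_chain). Qed.

(** Look at the least element of {x, y, z}: if it is [y] or [z], antisymmetry identifies it with its
    predecessor in the chain. *)
Lemma well_order_trans : transitive R.
Proof.
move=> y x z xy yz.
have [|t [[]]] := Rwo (A := [mem [:: x; y; z]]); first by exists x; rewrite !inE eqxx.
rewrite !inE => /or3P[] /eqP-> tmin _.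
- by apply: tmin; rewrite !inE eqxx !orbT.
- have yx : R y x by apply: tmin; rewrite !inE eqxx.
  by rewrite (@well_order_anti x y) // xy.
- have zy : R z y by apply: tmin; rewrite !inE eqxx orbT.
  by rewrite -(@well_order_anti y z) // yz.
Qed.

End WellOrder.

(** Minimise the key first, then apply [R0] among the elements with that key. *)
Lemma lexicographic_well_order (I : eqType) (key : I -> nat) (R0 : rel I) :
  well_order R0 ->
  well_order (fun x y => (key x < key y)%N || (key x == key y) && R0 x y).
Proof.
move=> R0wo; apply: antisymmetric_well_order => [x y|A [x0 Ax0]].
  have [xy|yx|E] := ltngtP (key x) (key y); rewrite /= ?andbF //.
  exact: well_order_anti.
have ex : exists n, `[< exists2 x, x \in A & key x = n >].
  by exists (key x0); apply/asboolP; exists x0.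
case: (ex_minnP ex) => n /asboolP[x1 Ax1 x1n] nmin.
have [|z [[]]] := R0wo [pred x in A | key x == n].
  by exists x1; rewrite inE Ax1 x1n /=.
rewrite inE => /andP[Az /eqP zn] zmin _; exists z; split=> // x Ax.
have := nmin (key x) (asboolT (ex_intro2 _ _ x Ax erefl)).
rewrite zn leq_eqVlt => /predU1P[nx|->//].
by rewrite nx eqxx zmin ?orbT // inE Ax nx /=.
Qed.

(** * Matrix coefficients of C'_s on a W-graph *)

Section WGraphCoordinates.
Variables (C : coxeterSystem) (H : heckeAlgebra C) (V : choiceType).
Variables (M : lmodType H) (b : V -> M) (G : wgraph (cox_gen C) V).
Hypothesis hb : is_basis (b : V -> amod H M).
Hypothesis hG : wgraph_on b G.

Lemma wgraph_coord_desc s x y : wg_desc G x s ->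
  coord hb (C's H s *: b x) y = quantum2 * (y == x)%:R.
Proof.
case: hG => _ /(_ s x)[E _] /E ->.
by rewrite -[_%:A *: b x]/(quantum2 *: (b x : amod H M)) coordZ coord_basis.
Qed.

Lemma wgraph_coord_ndesc s x y : ~ wg_desc G x s ->
  coord hb (C's H s *: b x) y =
  if `[< wg_desc G y s >] then (wg_mu G y x)%:~R else 0.
Proof.
case: hG => _ /(_ s x)[_ E] /E[fin ->].
set A := [set y | _] in fin *.
(* The index set may be infinite; it is cut down to the nonzero weights, finite by [wgraph_on]. *)
have -> : \sum_(z \in [set z | wg_desc G z s]) b z *~ wg_mu G z x =
    \sum_(z <- fset_set A) (wg_mu G z x)%:~R *: (b z : amod H M).
  rewrite -(fsbig_widen A); first last.
  - by move=> z [/= sz /not_andP[//|/negP]]; rewrite negbK => /eqP->; rewrite mulr0z.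
  - by move=> z [].
  by rewrite fsbig_finite //; apply: eq_bigr => z _; rewrite scaler_int.
rewrite (coord_sum hb _ (fun z => (wg_mu G z x)%:~R)) in_fset_set //.
case: asboolP => sy; case: ifPn => //; rewrite ?inE /A /=; last by case.
by move=> /asboolPn/not_andP[//|/negP]; rewrite negbK => /eqP->; rewrite mulr0z.
Qed.

End WGraphCoordinates.

(** * Modules with triangular projections *)

Lemma laurent_intr_inj : injective (fun z : int => z%:~R : laurent).
Proof.
move=> z z' /= E; have : evalA u z%:~R = evalA u z'%:~R by rewrite !rmorph_int.
move/evalAu_inj/(congr1 (fun p : {poly int} => p`_0)).
by rewrite -!(rmorph_int polyC) !coefC !intz.
Qed.

Lemma inj_surj_bijective (T T' : Type) (f : T -> T') :
  injective f -> (forall y, exists x, f x = y) -> bijective f.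
Proof.
move=> fi fs; exists (fun y => sval (cid (fs y))) => [x|y].
  by apply: fi; exact: (svalP (cid (fs (f x)))).
exact: (svalP (cid (fs y))).
Qed.

Section TriangularProjections.
Variables (C : coxeterSystem) (H : heckeAlgebra C) (V V' I : choiceType).
Variables (M N : lmodType H) (b : V -> M) (b' : V' -> N).
Variables (G : wgraph (cox_gen C) V) (G' : wgraph (cox_gen C) V').
Hypotheses (hG : wgraph_on b G) (hG' : wgraph_on b' G').
Variables (R : rel I) (lay : V -> I) (alpha : V -> V') (pi : I -> M -> N).
Hypothesis Rwo : well_order R.
(** With surjectivity below, [(lay, alpha)] identifies [V] with [I * V'], so each layer is a copy of
    [V']. *)
Hypothesis lay_alpha_inj : forall p p', lay p = lay p' -> alpha p = alpha p' -> p = p'.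
Hypothesis lay_alpha_surj : forall x t, exists2 p, lay p = x & alpha p = t.
Hypothesis piD : forall x m m', pi x (m + m') = pi x m + pi x m'.
Hypothesis piZ : forall x (h : H) m, pi x (h *: m) = h *: pi x m.
Hypothesis pi_upper : forall x p, pi x (b p) != 0 -> R x (lay p).
Hypothesis pi_top : forall p, pi (lay p) (b p) = b' (alpha p).

Local Notation hb := (proj1 hG).
Local Notation hb' := (proj1 hG').

Let Rtot := well_order_total Rwo.
Let Rtr := well_order_trans Rwo.
Let Ranti := well_order_anti Rwo.

Let Rxx x : R x x.
Proof. by have := Rtot x x; rewrite orbb. Qed.

Definition upto (x : I) : set V := [set p | R (lay p) x].

Lemma projection_sum x m :
  pi x m = \sum_(p <- finsupp (coordf hb m)) coord hb m p *: (pi x (b p) : amod H N).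
Proof.
have pi0 : pi x 0 = 0 by apply: (addrI (pi x 0)); rewrite -piD !addr0.
rewrite -{1}(lincomb_coord hb m) /lincomb.
rewrite (big_morph (pi x : amod H M -> amod H N) (piD x) pi0).
by apply: eq_bigr => p _; exact: piZ.
Qed.

(** Terms in layers strictly below [x] die under [pi x] by [pi_upper] and antisymmetry; those in
    layer [x] go to distinct vectors of [b']. *)
Lemma coord_projection x m : (forall p, coord hb m p != 0 -> R (lay p) x) ->
  forall p, lay p = x -> coord hb' (pi x m) (alpha p) = coord hb m p.
Proof.
move=> mx p px; rewrite projection_sum coord_big.
transitivity (\sum_(p' <- finsupp (coordf hb m)) coord hb m p' * (p == p')%:R).
  apply: eq_big_seq => p'; rewrite mem_finsupp => /mx p'x; rewrite coordZ.
  have [p'E|p'x'] := eqVneq (lay p') x.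
    rewrite -p'E pi_top coord_basis; congr (_ * (nat_of_bool _)%:R).
    apply/eqP/eqP => [E|->//]; apply: lay_alpha_inj => //.
    by rewrite px p'E.
  suff -> : pi x (b p') = 0.
    rewrite coord0; case: eqP => // pp'; move: p'x'.
    by rewrite -pp' px eqxx.
  apply: contrapT => /eqP/pi_upper xp'; move/eqP: p'x'; apply.
  by apply: Ranti; rewrite p'x.
case: (boolP (p \in finsupp (coordf hb m))) => pm; last first.
  rewrite [in RHS]/coord fsfun_dflt // big_seq big1 // => p' p'm.
  by case: eqP => [pp'|_]; rewrite ?mulr0 //; rewrite pp' p'm in pm.
rewrite (big_fsetD1 p) //= eqxx mulr1 big_seq big1 ?addr0 // => p'.
by rewrite !inE eq_sym => /andP[/negbTE -> _]; rewrite mulr0.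
Qed.

(** This presents the span as an intersection of kernels of H-linear maps, which makes it a
    submodule. *)
Lemma span_uptoP x m :
  span_of (b : V -> amod H M) (upto x) m <-> forall y, pi y m != 0 -> R y x.
Proof.
rewrite (span_ofP hb); split=> [mx y|mx p pm].
  apply: contraNT => Ryx; rewrite projection_sum big_seq; apply/eqP/big1 => p.
  rewrite mem_finsupp => /mx px; suff -> : pi y (b p) = 0 by exact: scaler0.
  apply: contrapT => /eqP/pi_upper yp; move/negP: Ryx; apply.
  exact: Rtr yp px.
(* In the topmost layer met by [m] the projection reads off coordinates, so it is nonzero and that
   layer lies below [x]. *)
have [] := @seq_max_key _ _ R lay (finsupp (coordf hb m)) p Rtot Rtr.
  by rewrite mem_finsupp.
move=> p' p'm pmax; apply: (Rtr (pmax p _)); first by rewrite mem_finsupp.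
apply: mx; apply: contraTneq p'm => p'0; rewrite mem_finsupp negbK.
rewrite -/(coord hb m p') -(@coord_projection (lay p')) ?p'0 ?coord0 // => q qm.
by apply: pmax; rewrite mem_finsupp.
Qed.

Lemma upto_cellular x : cellular_submodule b (upto x).
Proof.
move=> h m /span_uptoP mx; apply/span_uptoP => y; rewrite piZ => hm; apply: mx.
by apply: contraNneq hm => ->; rewrite scaler0.
Qed.

Lemma occurs_upto (h : H) p p' :
  occurs (b : V -> amod H M) p' (h *: b p) -> R (lay p') (lay p).
Proof.
move/(occursP hb); have := @upto_cellular (lay p) h (b p).
rewrite !(span_ofP hb) => hp; apply: hp => q; rewrite coord_basis.
by case: (q =P p) => [->|_]; [rewrite /upto /= Rxx|rewrite eqxx].
Qed.

(** Descents, weights and the preorder inside a layer are all transported through this equality of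
    matrix coefficients. *)
Lemma coord_layer (h : H) p p' : lay p' = lay p ->
  coord hb (h *: b p) p' = coord hb' (h *: b' (alpha p)) (alpha p').
Proof.
move=> pp'; rewrite -pi_top -piZ coord_projection // => q.
by move/occursP/occurs_upto.
Qed.

Lemma layer_upto x : layer R upto x = [set p | lay p = x].
Proof.
apply/seteqP; split=> p /=.
  case=> px np; apply: Ranti; rewrite px /=; apply: contrapT => /negP xp.
  apply: np; exists (lay p); rewrite /upto //=; rewrite px /=.
  by apply: contraNneq xp => ->.
move=> <-; split; first exact: Rxx.
by case=> y /= /andP[yp yp'] py; move/eqP: yp'; apply; apply: Ranti; rewrite yp.
Qed.

Lemma upto_filtration : cellular_filtration b R upto.
Proof.
split=> // [||]; first exact: upto_cellular.
  by move=> x y xy p px; apply: Rtr px xy.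
by apply/seteqP; split=> // p _; exists (lay p) => //; apply: Rxx.
Qed.

(** The diagonal coefficient of C'_s is [2] at a descent and 0 otherwise. *)
Lemma wg_desc_alpha p : wg_desc G' (alpha p) = wg_desc G p.
Proof.
apply/seteqP; split=> s.
  move=> s'; apply: contrapT => ns.
  have := @coord_layer (C's H s) p p erefl.
  rewrite (wgraph_coord_desc hb' hG') // (wgraph_coord_ndesc hb hG) //.
  case: asboolP => // _; rewrite eqxx mulr1 => /esym/eqP.
  by rewrite (negbTE quantum2_neq0).
move=> s'; apply: contrapT => ns.
have := @coord_layer (C's H s) p p erefl.
rewrite (wgraph_coord_desc hb hG) // (wgraph_coord_ndesc hb' hG') //.
case: asboolP => // _; rewrite eqxx mulr1 => /eqP.
by rewrite (negbTE quantum2_neq0).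
Qed.

(** For [s] a descent of [p'] but not of [p], the weight is the coefficient at [p'] of C'_s applied
    to [b p]. *)
Lemma wg_mu_alpha p p' : lay p' = lay p ->
  ~ (wg_desc G p' `<=` wg_desc G p) ->
  wg_mu G' (alpha p') (alpha p) = wg_mu G p' p.
Proof.
move=> pp' /existsNP[s /not_implyP[sp' sp]].
have := coord_layer (C's H s) pp'.
rewrite (wgraph_coord_ndesc hb hG) // (wgraph_coord_ndesc hb' hG') ?wg_desc_alpha //.
case: asboolP => // _ /esym; exact: laurent_intr_inj.
Qed.

Lemma layer_isomorphic x : wgraph_isomorphic (sub_wgraph G (layer R upto x)) G'.
Proof.
rewrite layer_upto; exists (fun p => alpha (val p)); split=> [|p|p' p nsub] /=.
- apply: inj_surj_bijective => [p p' E|t].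
    apply: val_inj; apply: lay_alpha_inj => //.
    by rewrite (set_valP p) (set_valP p').
  have [p px <-] := lay_alpha_surj x t.
  by exists (SigSub (mem_set px : p \in [set p | lay p = x])).
- exact: wg_desc_alpha.
- by apply: wg_mu_alpha => //; rewrite (set_valP p) (set_valP p').
Qed.

Lemma alpha_isomorphic (X : set V) (x : I) : X `<=` [set p | lay p = x] ->
  wgraph_isomorphic (sub_wgraph G X) (sub_wgraph G' (alpha @` X)).
Proof.
move=> Xx.
have aX (p : X) : alpha (val p) \in alpha @` X.
  by apply/mem_set; exists (val p) => //; apply: set_valP.
exists (fun p => SigSub (aX p)); split=> [|p|p' p nsub] /=.
- apply: inj_surj_bijective => [p p' /(congr1 val) /= E|t].
    apply: val_inj; apply: lay_alpha_inj => //.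
    by rewrite (Xx _ (set_valP p)) (Xx _ (set_valP p')).
  have [p Xp pt] := set_valP t.
  by exists (SigSub (mem_set Xp)); apply: val_inj.
- exact: wg_desc_alpha.
- by apply: wg_mu_alpha => //; rewrite (Xx _ (set_valP p)) (Xx _ (set_valP p')).
Qed.

Lemma wg_le_upto p p' : wg_le b p p' -> R (lay p) (lay p').
Proof.
elim=> {p p'} [p p' [h]|p|p q p' _ pq _ qp']; first exact: occurs_upto.
  exact: Rxx.
exact: Rtr pq qp'.
Qed.

(** Layers are monotone along the preorder, so a chain with both ends in one layer stays there and
    maps forward. Conversely, a chain in [V'] lifts vertex by vertex into the given layer. *)
Lemma wg_le_alpha p p' : lay p = lay p' ->
  wg_le b p p' <-> wg_le b' (alpha p) (alpha p').
Proof.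
move=> pp'; split.
  move=> le; elim: le pp' => {p p'} [p p' [h ho]|p|p q p' pq IH qp' IH'] pp'.
  - move: ho => /(occursP hb); rewrite coord_layer // => /(occursP hb') hp.
    by apply: rt_step; exists h.
  - by move=> *; apply: rt_refl.
  - have E : lay p = lay q.
      apply: Ranti; rewrite (wg_le_upto pq) pp'.
      by rewrite (wg_le_upto qp').
    by apply: rt_trans (IH E) (IH' _); rewrite -E.
move Et : (alpha p) => t; move Et' : (alpha p') => t' le.
elim: le p p' pp' Et Et' => {t t'} [t t' [h ho]|t|t q t' _ IH _ IH'] p p' pp' Et.
- move=> Et'; move: ho; rewrite -Et -Et' => /(occursP hb').
  rewrite -coord_layer // => /(occursP hb) hp.
  by apply: rt_step; exists h.
- by rewrite -Et => /esym/(lay_alpha_inj pp') ->; apply: rt_refl.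
- move=> Et'; have [r rp rq] := lay_alpha_surj (lay p) q.
  by apply: rt_trans (IH p r _ _ _) (IH' r p' _ _ _); rewrite ?rp.
Qed.

Lemma cell_isomorphic (X : set V) : is_cell b X ->
  exists Y : set V', is_cell b' Y /\
    wgraph_isomorphic (sub_wgraph G X) (sub_wgraph G' Y).
Proof.
case=> p0 XE; have Xx : X `<=` [set p | lay p = lay p0].
  rewrite XE => p /= [/wg_le_upto pp0 /wg_le_upto p0p].
  by apply: Ranti; rewrite pp0.
exists (alpha @` X); split; last exact: alpha_isomorphic Xx.
exists (alpha p0); apply/seteqP; split=> [_ [p Xp <-]|t /= [tp pt]].
  have pp0 := Xx _ Xp; move: Xp; rewrite XE /= => -[h1 h2].
  by split; apply/wg_le_alpha.
have [p pp0 pE] := lay_alpha_surj (lay p0) t; exists p => //.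
by rewrite XE /=; split; apply/wg_le_alpha; rewrite // pE.
Qed.

End TriangularProjections.

(** * The induced module *)

Section RightReps.
Variables (CJ C : coxeterSystem) (i : cox_gen CJ -> cox_gen C) (f : CJ -> C).
Hypothesis hf : parabolic_iso i f.

Definition right_reps : set C := [set x | min_reps (range i) (x^-1)%g].

Lemma right_decomp z : exists vx : CJ * right_reps, z = (f vx.1 * val vx.2)%g.
Proof.
have [v [x [rx ->]]] := min_repV_decomp hf z.
by exists (v, SigSub (mem_set rx : x \in right_reps)).
Qed.

(** The choice is harmless: the factorisation is unique by [min_repV_uniq]. *)
Definition Jpart z : CJ := (sval (cid (right_decomp z))).1.
Definition rpart z : right_reps := (sval (cid (right_decomp z))).2.

Lemma Jpart_rpart z : z = (f (Jpart z) * val (rpart z))%g.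
Proof. exact: svalP (cid (right_decomp z)). Qed.

Lemma parts_mul v (x : right_reps) :
  rpart (f v * val x)%g = x /\ Jpart (f v * val x)%g = v.
Proof.
have := Jpart_rpart (f v * val x)%g.
by case/esym/(min_repV_uniq hf (set_valP (rpart _)) (set_valP x)) => /val_inj.
Qed.

Lemma rpart_length z : (cox_length (val (rpart z)) <= cox_length z)%N.
Proof.
rewrite {2}[z]Jpart_rpart (min_repV_length hf) ?leq_addl //.
exact: (set_valP (rpart z)).
Qed.

Lemma hecke_T_parts (H : heckeAlgebra C) z :
  hecke_T H z = hecke_T H (f (Jpart z)) * hecke_T H (val (rpart z)).
Proof.
rewrite hecke_T_mul -?Jpart_rpart // {1}[z]Jpart_rpart.
by apply: (min_repV_length hf); exact: (set_valP (rpart z)).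
Qed.

End RightReps.

(** * Coordinates of H_2 over H_J *)

Section RightCoordinates.
Variables (C1 C2 CJ : coxeterSystem).
Variables (i2 : cox_gen CJ -> cox_gen C2) (f1 : CJ -> C1) (f2 : CJ -> C2).
Hypothesis hf2 : parabolic_iso i2 f2.
Variables (H1 : heckeAlgebra C1) (H2 : heckeAlgebra C2) (HJ : heckeAlgebra CJ).
Variables (iota1 : {lrmorphism HJ -> H1}) (iota2 : {lrmorphism HJ -> H2}).
Hypothesis hiota1 : forall w : CJ, iota1 (hecke_T HJ w) = hecke_T H1 (f1 w).
Hypothesis hiota2 : forall w : CJ, iota2 (hecke_T HJ w) = hecke_T H2 (f2 w).
Local Notation hb2 := (@hecke_T_basis C2 H2).
Local Notation hbJ := (@hecke_T_basis CJ HJ).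
Local Notation I := (right_reps i2).

(** In the decomposition of H_2 as the sum of the H_J T_x, this is the H_J-coefficient at T_x,
    carried into H_1 by [iota1]. *)
Definition rho (x : I) : H2 -> H1 := basis_ext hb2
  (fun z => if rpart hf2 z == x then hecke_T H1 (f1 (Jpart hf2 z)) else 0).

HB.instance Definition _ x := GRing.Linear.copy (rho x) (basis_ext hb2
  (fun z => if rpart hf2 z == x then hecke_T H1 (f1 (Jpart hf2 z)) else 0)).

Lemma rho_T x z :
  rho x (hecke_T H2 z) = if rpart hf2 z == x then hecke_T H1 (f1 (Jpart hf2 z)) else 0.
Proof. exact: basis_extE. Qed.

Lemma rho_iota_rep x x' (a : HJ) :
  rho x (iota2 a * hecke_T H2 (val x')) = if x' == x then iota1 a else 0.
Proof.
elim/(basis_ind hbJ): a => [|a a' E E'|c v].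
- by rewrite !rmorph0 mul0r linear0; case: ifP.
- by rewrite !rmorphD mulrDl linearD /= E E'; case: ifP; rewrite ?addr0.
rewrite !linearZ /= -scalerAl linearZ /= hiota1 hiota2.
have [E1 E2] := parts_mul hf2 v x'.
have := hecke_T_parts hf2 H2 (f2 v * val x')%g; rewrite E1 E2 => <-.
by rewrite rho_T E1 E2; case: ifP; rewrite ?scaler0.
Qed.

(** Each T_z is an element of H_J times T_x, and that element absorbs [a]. This makes
    [tau_rho_balanced] hold. *)
Lemma rho_iota x (a : HJ) h : rho x (iota2 a * h) = iota1 a * rho x h.
Proof.
elim/(basis_ind hb2): h => [|h h' E E'|c z].
- by rewrite mulr0 linear0 mulr0.
- by rewrite mulrDr !linearD /= E E' mulrDr.
rewrite -scalerAr !linearZ /= -scalerAr; congr (_ *: _).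
rewrite (hecke_T_parts hf2) -hiota2 mulrA -rmorphM !rho_iota_rep /=.
by case: ifP; rewrite ?rmorphM ?mulr0.
Qed.

End RightCoordinates.

(** * Components of the induced module and of its Howlett-Yin basis *)

Section InducedModule.
Variables (C1 C2 CJ : coxeterSystem).
Variables (i1 : cox_gen CJ -> cox_gen C1) (i2 : cox_gen CJ -> cox_gen C2).
Variables (f1 : CJ -> C1) (f2 : CJ -> C2).
Hypotheses (hf1 : parabolic_iso i1 f1) (hf2 : parabolic_iso i2 f2).
Variables (H1 : heckeAlgebra C1) (H2 : heckeAlgebra C2) (HJ : heckeAlgebra CJ).
Variables (iota1 : {lrmorphism HJ -> H1}) (iota2 : {lrmorphism HJ -> H2}).
Hypothesis hiota1 : forall w : CJ, iota1 (hecke_T HJ w) = hecke_T H1 (f1 w).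
Hypothesis hiota2 : forall w : CJ, iota2 (hecke_T HJ w) = hecke_T H2 (f2 w).
Variables (KL1 : C1 -> H1) (KL2 : C2 -> H2).
Hypotheses (hKL1 : is_KL_basis KL1) (hKL2 : is_KL_basis KL2).
Variables (E : lmodType H1) (tau : H1 -> restrict_scalars iota2 H2^o -> E).
Variable Ct : induced_vertex i1 C2 -> E.
Hypothesis htau : is_tensor iota1 tau.
Hypothesis hCt : is_HY_basis (KL2 : C2 -> restrict_scalars iota2 H2^o) tau Ct.

Local Notation hb1 := (@hecke_T_basis C1 H1).
Local Notation hb2 := (@hecke_T_basis C2 H2).
Local Notation T1 := (hecke_T H1).
Local Notation T2 := (hecke_T H2).
Local Notation I := (right_reps i2).
Local Notation V := (induced_vertex i1 C2).
Local Notation rho := (@rho C1 C2 CJ i2 f1 f2 hf2 H1 H2).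
Local Notation rpart := (rpart hf2).
Local Notation Jpart := (Jpart hf2).

Fact tau_rho_balanced (x : I) :
  balanced iota1 (fun (h : H1) (e : restrict_scalars iota2 H2^o) => h * rho x e).
Proof.
split=> [h h' e|h e e'|h a e]; first by rewrite mulrDl.
- by rewrite -[e + e']/((e : H2) + (e' : H2)) linearD /= mulrDr.
- by rewrite -[a *: e]/(iota2 a * (e : H2)) (rho_iota _ hiota1 hiota2) mulrA.
Qed.

Fact tensor_coord_ex (x : I) : exists g : E -> H1, zmod_morphism g /\
  forall h e, g (tau h e) = h * rho x e.
Proof.
case: htau => _ _ /(_ H1 _ (tau_rho_balanced x))[g [gP _]].
by exists g.
Qed.

(** The component in H_1 (x) T_x. The universal property yields only an additive map; linearity over
    H_1 follows in [tensor_coordM]. *)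
Definition tensor_coord (x : I) : E -> H1 := sval (cid (tensor_coord_ex x)).
Local Notation pi := tensor_coord.

Lemma tensor_coord_tau x h e : pi x (tau h e) = h * rho x e.
Proof. by have [_] := svalP (cid (tensor_coord_ex x)); apply. Qed.

Lemma tensor_coordB x : zmod_morphism (pi x).
Proof. by case: (svalP (cid (tensor_coord_ex x))). Qed.

Lemma tensor_coord0 x : pi x 0 = 0.
Proof. by rewrite -[0 in LHS](subrr 0) tensor_coordB subrr. Qed.

Lemma tensor_coordD x m m' : pi x (m + m') = pi x m + pi x m'.
Proof.
rewrite -{1}[m']opprK tensor_coordB; congr (_ + _).
by rewrite -[- m']sub0r tensor_coordB tensor_coord0 sub0r opprK.
Qed.

Lemma tau0 e : tau 0 e = 0.
Proof. by case: htau => -[tD _ _] _ _; apply: (addrI (tau 0 e)); rewrite -tD !addr0. Qed.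

Lemma tau0r h : tau h 0 = 0.
Proof. by case: htau => -[_ tD _] _ _; apply: (addrI (tau h 0)); rewrite -tD !addr0. Qed.

Lemma tau_scale (c : laurent) h e : c%:A *: tau h e = tau (c *: h) e.
Proof. by case: htau => _ tZ _; rewrite -tZ mulr_algl. Qed.

Lemma tau_T h z :
  tau h (T2 z) = tau (h * T1 (f1 (Jpart z))) (T2 (val (rpart z))).
Proof.
case: htau => -[_ _ tJ] _ _; rewrite -hiota1 tJ; congr (tau h _).
by rewrite [LHS](hecke_T_parts hf2) -hiota2.
Qed.

(** Factors from H_J move across the tensor sign, leaving some T_x on the right. *)
Lemma tau_ind (P : E -> Prop) :
  P 0 -> (forall m m', P m -> P m' -> P (m + m')) ->
  (forall h (x : I), P (tau h (T2 (val x)))) -> forall m, P m.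
Proof.
move=> P0 PD PT.
have Ptau h (e : H2) : P (tau h e).
  case: (htau) => -[_ tD tJ] _ _.
  elim/(basis_ind hb2): e => [|e e' Pe Pe'|c z]; first by rewrite tau0r.
    by rewrite -[e + e']/((e : restrict_scalars iota2 H2^o) + e') tD; apply: PD.
  have -> : c *: T2 z = (c%:A : HJ) *: (T2 z : restrict_scalars iota2 H2^o).
    by rewrite -[RHS]/(iota2 c%:A * T2 z) linearZ /= rmorph1 mulr_algl.
  by rewrite -tJ tau_T.
(* Pure tensors generate [E] because every Howlett-Yin basis vector is a finite sum of them. *)
case: hCt => hb [barH [barE [barM [_ _ _ _ CtP]]]].
apply: (basis_ind hb) => // c p.
have [_ [a _ aE]] := CtP p.
rewrite -[X in P X]/(c%:A *: Ct p) -[Ct p](subrK (tau (T1 (val p.1)) (KL2 p.2))).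
rewrite aE scalerDr; apply: (PD); last by rewrite tau_scale.
rewrite /lincomb scaler_sumr; apply: (big_ind P P0 PD) => q _.
by rewrite -[a q *: _]/((a q)%:A *: tau _ _) !tau_scale.
Qed.

Lemma tensor_coordM x (h : H1) m : pi x (h *: m) = h * pi x m.
Proof.
elim/tau_ind: m => [|m m' E1 E2|h' y]; first by rewrite scaler0 tensor_coord0 mulr0.
  by rewrite scalerDr !tensor_coordD E1 E2 mulrDr.
by case: htau => _ tZ _; rewrite -tZ !tensor_coord_tau mulrA.
Qed.

Lemma tensor_coord_tau_rep x h (y : I) :
  pi x (tau h (T2 (val y))) = if y == x then h else 0.
Proof.
have := rho_iota_rep hf2 hiota1 hiota2 x y 1.
rewrite !rmorph1 mul1r tensor_coord_tau => ->.
by case: ifP; rewrite ?mulr1 ?mulr0.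
Qed.

(** Allowing every larger [r'] lets supports be merged and extra indices be adjoined. *)
Lemma tensor_decomp m : exists r : {fset I},
  (forall x, x \notin r -> pi x m = 0) /\
  forall r' : {fset I}, (r `<=` r')%fset ->
    m = \sum_(x <- r') tau (pi x m) (T2 (val x)).
Proof.
case: htau => -[tD _ _] _ _.
elim/tau_ind: m => [|m m' [r [r0 rE]] [r' [r0' rE']]|h y].
- exists fset0; split=> [x _|r' _]; first exact: tensor_coord0.
  by rewrite big1 // => x _; rewrite tensor_coord0 tau0.
- exists (r `|` r')%fset; split=> [x|s /fsubUsetP[rs rs']].
    by rewrite in_fsetU negb_or tensor_coordD => /andP[/r0 -> /r0' ->]; rewrite addr0.
  rewrite {1}(rE _ rs) {1}(rE' _ rs') -big_split; apply: eq_bigr => x _.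
  by rewrite tensor_coordD tD.
- exists [fset y]%fset; split=> [x|s ys].
    by rewrite inE eq_sym tensor_coord_tau_rep => /negbTE->.
  rewrite (big_fsetD1 y) ?(fsubsetP ys) ?inE //= tensor_coord_tau_rep eqxx.
  rewrite big_seq big1 ?addr0 // => x.
  by rewrite !inE eq_sym tensor_coord_tau_rep => /andP[/negbTE-> _]; rewrite tau0.
Qed.

Definition layer_index (p : V) : I := rpart p.2.
Definition layer_vertex (p : V) : C1 := (val p.1 * f1 (Jpart p.2))%g.
Local Notation lay := layer_index.
Local Notation alpha := layer_vertex.

Lemma layer_inj p p' : lay p = lay p' -> alpha p = alpha p' -> p = p'.
Proof.
case: p p' => [w z] [w' z']; rewrite /lay /alpha /= => E1.
case/(min_rep_uniq hf1 (set_valP w) (set_valP w')) => /val_inj -> E2.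
by rewrite (Jpart_rpart hf2 z) (Jpart_rpart hf2 z') E1 E2.
Qed.

Lemma layer_surj x t : exists2 p, lay p = x & alpha p = t.
Proof.
have [w [v [rw ->]]] := min_rep_decomp hf1 t.
have [E1 E2] := parts_mul hf2 v x.
exists (SigSub (mem_set rw : w \in min_reps (range i1)), (f2 v * val x)%g) => //.
by rewrite /alpha /= E2.
Qed.

Lemma hecke_T_rho (w : min_reps (range i1)) y z : T1 (val w) * rho y (T2 z) =
  if lay (w, z) == y then T1 (alpha (w, z)) else 0.
Proof.
rewrite rho_T /lay /alpha /=; case: ifP; rewrite ?mulr0 // => _.
by rewrite hecke_T_mul // (min_rep_length hf1) //; exact: (set_valP w).
Qed.

Let U (h : H1) := forall t, uAminus (coord hb1 h t).

Let UD h h' : U h -> U h' -> U (h + h').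
Proof. by move=> Uh Uh' t; rewrite coordD; apply: uAminusD. Qed.

Let U0 : U 0.
Proof. by move=> t; rewrite coord0; apply: uAminus0. Qed.

Let leading y p := if lay p == y then T1 (alpha p) else 0.

Let U_leading a y p : uAminus a -> U (a *: leading y p).
Proof.
move=> aA; rewrite /leading; case: ifP => _; last by rewrite scaler0.
move=> t; rewrite coordZ coord_basis; case: (t == _); rewrite ?mulr1 ?mulr0 //.
exact: uAminus0.
Qed.

Let U_KL y (p : V) : U (T1 (val p.1) * rho y (KL2 p.2) - leading y p).
Proof.
case: hKL2 => _ [bar2 _ /(_ p.2)[_ [a aA aE]]].
rewrite {1}[p]surjective_pairing /leading -hecke_T_rho -mulrBr -linearB aE.
rewrite /lincomb linear_sum mulr_sumr; apply: big_ind => // z _.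
by rewrite linearZ /= -scalerAr hecke_T_rho; apply: U_leading.
Qed.

Lemma tensor_coordZ y (c : laurent) m : pi y (c%:A *: m) = c *: pi y m.
Proof. by rewrite tensor_coordM mulr_algl. Qed.

(** The Howlett-Yin congruence compares with T_w (x) C'_z, so the Kazhdan-Lusztig congruence [U_KL]
    is needed as a second step to reach T_w (x) T_z. *)
Let U_tensor_coord y p : U (pi y (Ct p) - leading y p).
Proof.
case: hCt => hb [barH [barE [barM [_ _ _ _ /(_ p)[_ [a aA aE]]]]]].
rewrite -[Ct p](subrK (tau (T1 (val p.1)) (KL2 p.2))) tensor_coordD tensor_coord_tau -addrA.
apply: UD (U_KL y p); rewrite aE /lincomb.
rewrite (big_morph (pi y) (tensor_coordD y) (tensor_coord0 y)).
apply: big_ind => // q _.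
rewrite -[X in pi y X]/((a q)%:A *: tau (T1 (val q.1)) (KL2 q.2)).
rewrite tensor_coordZ tensor_coord_tau.
rewrite -[_ * rho _ _](subrK (leading y q)) scalerDr; apply: UD; last exact: U_leading.
by move=> t; rewrite coordZ; apply: uAminusM => //; apply: U_KL.
Qed.

Section Bar.
Variables (barH : H1 -> H1) (barE : H2 -> H2) (barM : E -> E).
Hypothesis hbarH : is_hecke_bar barH.
Hypothesis hbarE : is_wgraph_bar (KL2 : C2 -> restrict_scalars iota2 H2^o) barE.
Hypothesis barMD : {morph barM : m m' / m + m'}.
Hypothesis barM_tau : forall h e, barM (tau h e) = tau (barH h) (barE e).

(** Both [barE] and the bar map of H_2 fix the Kazhdan-Lusztig basis, so they agree. *)
Lemma wgraph_bar_hecke : is_hecke_bar barE.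
Proof.
case: hKL2 => b2 [bar2 hbar2 KL2b]; have [bar2D bar2Z _] := hbar2.
suff E12 : barE =1 bar2 by rewrite (funext E12).
case: hbarE => barED barEZ barEb.
apply: (semilinear_eq b2 barED bar2D _ bar2Z) => [c x|z].
  have AE (d : laurent) y : d%:A *: (y : restrict_scalars iota2 H2^o) = d *: (y : H2).
    by rewrite -[LHS]/(iota2 d%:A * y) linearZ /= rmorph1 mulr_algl.
  by have := barEZ c x; rewrite !AE.
by rewrite barEb; have [] := KL2b z.
Qed.

(** The bar of h (x) T_x is bar h (x) T_x plus terms bar h (x) T_z with [z] shorter than [x], and
    these do not reach [y]. *)
Lemma tensor_coord_bar_top y m :
  (forall x, pi x m != 0 -> (cox_length (val x) <= cox_length (val y))%N) ->
  pi y (barM m) = barH (pi y m).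
Proof.
move=> my; have barM0 : barM 0 = 0.
  by apply: (addrI (barM 0)); rewrite -barMD !addr0.
have barH0 := hecke_bar0 hbarH.
have piE h (x : I) : (cox_length (val x) <= cox_length (val y))%N ->
    pi y (tau (barH h) (barE (T2 (val x)))) = if x == y then barH h else 0.
  move=> xy; rewrite tensor_coord_tau -[barE _](subrK (T2 (val x))) linearD /= mulrDr.
  rewrite -[X in _ + X]tensor_coord_tau tensor_coord_tau_rep.
  suff -> : rho y (barE (T2 (val x)) - T2 (val x)) = 0 by rewrite mulr0 add0r.
  have := @hecke_bar_T _ _ _ wgraph_bar_hecke (val x).
  move/shorter_sum => /(_ (fun h => rho y h = 0)); apply=> [|e e' E1 E2|c z zx].
  - exact: linear0.
  - by rewrite linearD /= E1 E2 addr0.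
  (* If [rpart z] were [y], then [z] would be at least as long as [y], hence as [x]. *)
  - rewrite linearZ /= rho_T ifN ?scaler0 //; apply: contraTneq zx => zy.
    by rewrite -leqNgt (leq_trans xy) // -zy rpart_length.
have [r [r0 rE]] := tensor_decomp m.
rewrite {1}(rE (r `|` [fset y])%fset) ?fsubsetUl //.
rewrite (big_morph barM barMD barM0) (big_morph (pi y) (tensor_coordD y) (tensor_coord0 y)).
rewrite (big_fsetD1 y) ?in_fsetU ?inE ?eqxx ?orbT //= barM_tau piE // eqxx.
rewrite big_seq big1 ?addr0 // => x; rewrite in_fsetD1 => /andP[xy _].
have [x0|x0] := eqVneq (pi x m) 0; last by rewrite barM_tau piE ?my // (negbTE xy).
by rewrite x0 tau0 barM0 tensor_coord0.
Qed.

End Bar.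

Lemma tensor_coord_HY_eq0 (y : I) p :
  (cox_length (val (lay p)) <= cox_length (val y))%N ->
  y != lay p -> pi y (Ct p) = 0.
Proof.
have [barH [barE [barM [hbarH hbarE barMD barM_tau /(_ p)[CtP _]]]]] := proj2 hCt.
move=> py yp; apply: contrapT => /eqP y0.
have [r [r0 _]] := tensor_decomp (Ct p).
have inr x : pi x (Ct p) != 0 -> x \in r by apply: contraNT => /r0 ->.
(* The index [lay p] is left out because its component has the leading term T_(wv). It does not
   spoil the maximality of the chosen [x], being no longer than [y] and so than [x]. *)
pose r' := [seq x <- r | (pi x (Ct p) != 0) && (x != lay p)].
have [] := @seq_max_key _ _ leq (fun x : I => cox_length (val x)) r' y
  leq_total leq_trans.
  by rewrite mem_filter y0 yp inr.
move=> x; rewrite mem_filter => /andP[/andP[x0 xp] xr] xmax.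
have yx : (cox_length (val y) <= cox_length (val x))%N.
  by apply: xmax; rewrite mem_filter y0 yp inr.
have top : pi x (barM (Ct p)) = barH (pi x (Ct p)).
  apply: (tensor_coord_bar_top hbarH hbarE barMD barM_tau) => z z0.
  have [->|zp] := eqVneq z (lay p); first exact: leq_trans py yx.
  by apply: xmax; rewrite mem_filter z0 zp inr.
move/eqP: x0; apply; apply: (hecke_bar_invariant_eq0 hbarH).
  by rewrite -top CtP.
by move=> t; have := U_tensor_coord x p t; rewrite /leading eq_sym (negbTE xp) subr0.
Qed.

Lemma tensor_coord_HY_top p : pi (lay p) (Ct p) = KL1 (alpha p).
Proof.
have [barH [barE [barM [hbarH hbarE barMD barM_tau /(_ p)[CtP _]]]]] := proj2 hCt.
apply: (KL_basis_unique hbarH hKL1).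
  rewrite -{2}CtP; apply/esym/(tensor_coord_bar_top hbarH hbarE barMD barM_tau) => x x0.
  rewrite leqNgt; apply: contraNN x0 => xp; apply/eqP/tensor_coord_HY_eq0.
    exact: ltnW.
  by apply: contraTneq xp => ->; rewrite ltnn.
by move=> t; have := U_tensor_coord (lay p) p t; rewrite /leading eqxx.
Qed.

End InducedModule.

Theorem theorem3p5
  (C1 C2 CJ : coxeterSystem)
  (i1 : cox_gen CJ -> cox_gen C1) (i2 : cox_gen CJ -> cox_gen C2)
  (f1 : CJ -> C1) (f2 : CJ -> C2)
  (hf1 : parabolic_iso i1 f1) (hf2 : parabolic_iso i2 f2)
  (H1 : heckeAlgebra C1) (H2 : heckeAlgebra C2) (HJ : heckeAlgebra CJ)
  (iota1 : {lrmorphism HJ -> H1}) (iota2 : {lrmorphism HJ -> H2})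
  (hiota1 : forall w : CJ, iota1 (hecke_T HJ w) = hecke_T H1 (f1 w))
  (hiota2 : forall w : CJ, iota2 (hecke_T HJ w) = hecke_T H2 (f2 w))
  (KL1 : C1 -> H1) (KL2 : C2 -> H2)
  (hKL1 : is_KL_basis KL1) (hKL2 : is_KL_basis KL2)
  (G1 : wgraph (cox_gen C1) C1) (G2 : wgraph (cox_gen C2) C2)
  (hG1 : wgraph_on (KL1 : C1 -> H1^o) G1)
  (hG2 : wgraph_on (KL2 : C2 -> H2^o) G2)
  (E : lmodType H1) (tau : H1 -> restrict_scalars iota2 H2^o -> E)
  (Ct : induced_vertex i1 C2 -> E)
  (Lam : wgraph (cox_gen C1) (induced_vertex i1 C2))
  (hLam : is_induced_wgraph iota1 (KL2 : C2 -> restrict_scalars iota2 H2^o)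
            tau (res_wgraph i2 G2) Ct Lam) :
  (exists (I : choiceType) (R : rel I) (F : I -> set (induced_vertex i1 C2)),
     cellular_filtration Ct R F /\
     forall k : I, wgraph_isomorphic (sub_wgraph Lam (layer R F k)) G1) /\
  (forall X : set (induced_vertex i1 C2), is_cell Ct X ->
     exists Y : set C1, is_cell (KL1 : C1 -> H1^o) Y /\
       wgraph_isomorphic (sub_wgraph Lam X) (sub_wgraph G1 Y)).
Proof.
case: hLam => _ htau hCt hGL.
have [R0 R0wo] := well_ordering_principle (right_reps i2).
pose key (x : right_reps i2) := cox_length (val x).
(* Length comes first; [R0] breaks ties among representatives of equal length. *)
pose R x y := (key x < key y)%N || (key x == key y) && R0 x y.
have Rwo : well_order R := lexicographic_well_order key R0wo.
pose pi x : E -> H1^o := tensor_coord hf2 hiota1 hiota2 htau x.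
pose lay := @layer_index C1 C2 CJ i1 i2 f2 hf2.
have upper x p : pi x (Ct p) != 0 -> R x (lay p).
  have [->|xp] := eqVneq x (lay p).
    by have := well_order_total Rwo (lay p) (lay p); rewrite orbb.
  (* For [x] other than [lay p] and at least as long, the component vanishes, so equal lengths are
     covered whatever [R0] says. *)
  rewrite /R; case: ltnP => // le; apply: contraNT => _; apply/eqP.
  exact: (tensor_coord_HY_eq0 hf1 hiota1 hiota2 hKL2 htau hCt).
have top p : pi (lay p) (Ct p) = (KL1 : C1 -> H1^o) (layer_vertex f1 hf2 p).
  exact: (tensor_coord_HY_top hf1 hf2 hiota1 hiota2 hKL1 hKL2 htau hCt).
have inj := @layer_inj _ _ _ _ _ _ _ hf1 hf2.
have surj := layer_surj hf1 hf2.
have piA x m m' : pi x (m + m') = pi x m + pi x m' by exact: tensor_coordD.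
have piS x (h : H1) m : pi x (h *: m) = h *: pi x m.
  exact: (tensor_coordM hf2 hiota1 hiota2 htau hCt).
split; last first.
  exact: (cell_isomorphic hGL hG1 Rwo inj surj piA piS upper top).
exists (right_reps i2), R, (upto R lay); split.
  exact: (upto_filtration hGL hG1 Rwo inj piA piS upper top).
exact: (layer_isomorphic hGL hG1 Rwo inj surj piA piS upper top).
Qed.
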